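(* Let $\mathbf{F}$ be a field of characteristic $3$ and let $\lambda=(\lambda_1,\lambda_2)$ and $\mu=(\mu_1,\mu_2)$ be partitions of $r$ with at most two parts such that the Young module $Y^\mu$ is (isomorphic to) a direct summand of $M^\lambda$. Put $m=\lambda_1-\lambda_2$ and $g=\lambda_2-\mu_2$. Then $e_{m,g}$ is the primitive idempotent in $S_\mathbf{F}(\lambda)$ such that $e_{m,g}M^\lambda\cong Y^\mu$.
   Context: For a partition $\lambda=(\lambda_1,\lambda_2)$ of $r$, $M^\lambda$ is the $\mathbf{F}S_r$-permutation module on the cosets of the Young subgroup $S_{\lambda_1}\times S_{\lambda_2}$, and $S_\mathbf{F}(\lambda)=\operatorname{End}_{\mathbf{F}S_r}(M^\lambda)$. The Young module $Y^\mu$ is the (unique up to isomorphism) indecomposable direct summand of $M^\mu$ containing the Specht module $S^\mu$. Let $E$ have basis $v_1,v_2$; $S_r$ acts on $E^{\otimes r}$ by place permutations, $M^\lambda$ is identified with the span of $v_{i_1}\otimes\cdots\otimes v_{i_r}$ having exactly $\lambda_1$ entries $1$ and $\lambda_2$ entries $2$, and $1_\lambda$ is the projection of $E^{\otimes r}$ onto $M^\lambda$. With $e=e_{21},f=e_{12}\in\mathfrak{gl}_2$ acting on $E^{\otimes r}$ and divided powers $e^{(i)}=e^i/i!$, $f^{(i)}=f^i/i!$ (defined integrally and reduced mod 3), $b(i)=1_\lambda f^{(i)}e^{(i)}1_\lambda\in S_\mathbf{F}(\lambda)$. Then $S_\mathbf{F}(\lambda)$ is commutative with basis $b(0)=\mathbf{1},\dots,b(\lambda_2)$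 and $b(i)b(j)=\sum_{h=\max\{i,j\}}^{i+j}\binom{h}{i}\binom{h}{j}\binom{m+i+j}{i+j-h}b(h)$, with $b(a)=0$ for $a>\lambda_2$. $B(m,g)=\binom{m+2g}{g}$. For $B(m,g)\not\equiv0\pmod3$, with base-3 digits $(m+2g)_u,g_u$, let $I^{(0)}=\{u: g_u=0,(m+2g)_u=0\}$, $J^{(0)}=\{u:g_u=1,(m+2g)_u=2\}$, $I^{(1)}=\{u:g_u=0,(m+2g)_u=1\}$, $J^{(1)}=\{u:g_u=2,(m+2g)_u=2\}$, $I^{(2)}=\{u:g_u=0,(m+2g)_u=2\}$, $J^{(2)}=\{u:g_u=1,(m+2g)_u=1\}$ and \[e_{m,g}=\prod_{u\in I^{(0)}}(\mathbf{1}+b(3^u)-b(2\cdot3^u))\prod_{u\in J^{(0)}}(b(2\cdot3^u)-b(3^u))\prod_{u\in I^{(1)}}(\mathbf{1}-b(2\cdot3^u))\prod_{u\in J^{(1)}}b(2\cdot3^u)\prod_{u\in I^{(2)}}(\mathbf{1}-b(3^u)+b(2\cdot3^u))\prod_{u\in J^{(2)}}(b(3^u)-b(2\cdot3^u)),\] with $b(a)=0$ for $a>\lambda_2$. *)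

(* Defs.v *)
From HB Require Import structures.
From mathcomp Require Import all_boot all_order all_algebra all_fingroup.
From mathcomp Require Import mxrepresentation.
Set Implicit Arguments. Unset Strict Implicit. Unset Printing Implicit Defensive.
Import GRing.Theory.
Local Open Scope ring_scope.

(* E^{(x)r}: basis vectors v_{i_1} (x) ... (x) v_{i_r} are indexed by words   *)
(* w : 'I_r -> bool, with  w k = false  <->  i_k = 1  and  w k = true <-> i_k = 2. *)
(* Vectors of E^{(x)r} are row vectors 'rV[F]_#|word r|, the coordinate at    *)
(* index i being the coefficient of the basis vector v_(enum_val i).           *)
(* Operators act on the right of row vectors (x |-> x *m A), so A i j is the   *)
(* coefficient of v_(enum_val j) in the image of v_(enum_val i).               *)

Definition word (r : nat) := {ffun 'I_r -> bool}.

Notation dimE r := #|{: word r}|.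

Definition twos r (w : word r) : {set 'I_r} := [set k | w k].

Definition wmx (F : fieldType) r (c : word r -> word r -> F) : 'M[F]_(dimE r) :=
  \matrix_(i, j) c (enum_val i) (enum_val j).

Definition wact r (w : word r) (s : 'S_r) : word r := [ffun k => w ((s^-1)%g k)].

Definition Sr_mx (F : fieldType) r (s : 'S_r) : 'M[F]_(dimE r) :=
  wmx (fun w w' => ((w' == wact w s) : bool)%:R).

Lemma wact1 r (w : word r) : wact w 1%g = w.
Proof. by apply/ffunP=> k; rewrite ffunE invg1 perm1. Qed.

Lemma wactM r (w : word r) s t : wact (wact w s) t = wact w (s * t)%g.
Proof. by apply/ffunP=> k; rewrite !ffunE invMg permM. Qed.

Lemma Sr_mx_repr (F : fieldType) r : mx_repr [set: 'S_r] (@Sr_mx F r).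
Proof.
split.
  apply/matrixP=> i j; rewrite !mxE wact1.
  by rewrite (inj_eq enum_val_inj) eq_sym.
move=> s t _ _; apply/matrixP=> i j; rewrite !mxE.
rewrite (bigD1 (enum_rank (wact (enum_val i) s))) //= !mxE enum_rankK eqxx mul1r.
rewrite wactM big1 ?addr0 // => k /negPf nk; rewrite !mxE.
case: eqP => [ek|]; last by rewrite mul0r.
by rewrite -ek enum_valK eqxx in nk.
Qed.

Definition Sr_repr (F : fieldType) r : mx_representation F [set: 'S_r] (dimE r) :=
  MxRepresentation (@Sr_mx_repr F r).

(* 1_lambda, for lambda = (r - l2, l2): projection of E^{(x)r} onto M^lambda.  *)
(* Its row space is M^lambda = span of the words with exactly l2 entries 2.   *)
Definition one_lam (F : fieldType) r (l2 : nat) : 'M[F]_(dimE r) :=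
  wmx (fun w w' => ((w == w') && (#|twos w| == l2)%N : bool)%:R).

(* Divided powers e^{(i)} and f^{(i)} on E^{(x)r} (integral forms, reduced to F):*)
(* e^{(i)} v_w = sum over the i-subsets T of positions of w carrying 2 of     *)
(* the word obtained by replacing those entries by 1;                          *)
(* f^{(i)} v_w = sum over the i-subsets T of positions of w carrying 1 of     *)
(* the word obtained by replacing those entries by 2.                          *)
Definition e_div (F : fieldType) r (i : nat) : 'M[F]_(dimE r) :=
  wmx (fun w w' =>
    ((twos w' \subset twos w) && (#|twos w| == #|twos w'| + i)%N : bool)%:R).

Definition f_div (F : fieldType) r (i : nat) : 'M[F]_(dimE r) :=
  wmx (fun w w' =>
    ((twos w \subset twos w') && (#|twos w'| == #|twos w| + i)%N : bool)%:R).

(* b(i) = 1_lambda f^{(i)} e^{(i)} 1_lambda  (e^{(i)} applied first), with the *)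
(* convention b(a) = 0 for a > lambda_2.                                       *)
Definition bb (F : fieldType) r (l2 i : nat) : 'M[F]_(dimE r) :=
  if (i <= l2)%N then
    one_lam F r l2 *m e_div F r i *m f_div F r i *m one_lam F r l2
  else 0.

Definition digit3 (n u : nat) : nat := (n %/ 3 ^ u) %% 3.

Definition Bmg (m g : nat) : nat := 'C(m + 2 * g, g).

Definition emg_factor (F : fieldType) r (l2 m g u : nat) : 'M[F]_(dimE r) :=
  let one := one_lam F r l2 in
  let b1 := bb F r l2 (3 ^ u)%N in
  let b2 := bb F r l2 (2 * 3 ^ u)%N in
  match digit3 g u, digit3 (m + 2 * g)%N u with
  | 0, 0 => one + b1 - b2
  | 1, 2 => b2 - b1
  | 0, 1 => one - b2
  | 2, 2 => b2
  | 0, 2 => one - b1 + b2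
  | 1, 1 => b1 - b2
  | _, _ => 0                  (* g_u > (m+2g)_u : only when B(m,g) = 0 mod 3 *)
  end.

(* e_{m,g}: the factors for u > r are all equal to 1 = 1_lambda (there    *)
(* 3^u > r >= lambda_2 >= g, so g_u = 0 and b(3^u) = b(2*3^u) = 0), so the  *)
(* infinite product reduces to the product over u <= r.                   *)
Definition e_mg (F : fieldType) r (l2 m g : nat) : 'M[F]_(dimE r) :=
  \prod_(u < r.+1) emg_factor F r l2 m g u.

(* Specht module S^mu, mu = (r - k, k), inside M^mu: the span of the          *)
(* polytabloids e_t.  A tableau t of shape mu contributes through its k       *)
(* columns of length 2: column c has entry a_c := (t c).1 in row 1 and        *)
(* b_c := (t c).2 in row 2; all 2k entries are distinct.  The tabloid {t}     *)
(* is identified with the word having entries 2 exactly at the row-2         *)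
(* positions, and e_t = sum_{pi in C_t} sgn(pi) {pi t}.                        *)

Definition coltab (r k : nat) := {ffun 'I_k -> 'I_r * 'I_r}.

Definition coltab_ok r k (t : coltab r k) : bool :=
  uniq (flatten [seq [:: (t c).1; (t c).2] | c <- enum 'I_k]).

(* word of the tabloid obtained after swapping the columns c with s c = true *)
Definition tab_word r k (t : coltab r k) (s : {ffun 'I_k -> bool}) : word r :=
  [ffun p => [exists c, p == (if s c then (t c).1 else (t c).2)]].

Definition polytabloid (F : fieldType) r k (t : coltab r k) : 'rV[F]_(dimE r) :=
  \row_j \sum_(s : {ffun 'I_k -> bool})
          (-1) ^+ #|[set c | s c]| * ((enum_val j == tab_word t s) : bool)%:R.

Definition Specht (F : fieldType) r (k : nat) : 'M[F]_(dimE r) :=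
  (\sum_(t : coltab r k | coltab_ok t) <<polytabloid F t>>)%MS.

Definition is_summand (F : fieldType) r (M Y : 'M[F]_(dimE r)) : Prop :=
  [/\ mxmodule (Sr_repr F r) Y, (Y <= M)%MS & inhabited (mxsplits (Sr_repr F r) M Y)].

Definition indecomposable (F : fieldType) r (Y : 'M[F]_(dimE r)) : Prop :=
  [/\ mxmodule (Sr_repr F r) Y, Y != 0 &
      forall U W : 'M[F]_(dimE r),
        mxmodule (Sr_repr F r) U -> mxmodule (Sr_repr F r) W ->
        (U + W :=: Y)%MS -> mxdirect (U + W) -> U = 0 \/ W = 0].

Definition is_Young (F : fieldType) r (k : nat) (Y : 'M[F]_(dimE r)) : Prop :=
  [/\ is_summand (one_lam F r k) Y, indecomposable Y & (Specht F r k <= Y)%MS].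

(* S_F(lambda) = End_{FS_r}(M^lambda), realised as the operators A on       *)
(* E^{(x)r} with A = 1_lambda A 1_lambda commuting with the S_r-action.       *)
Definition in_Schur (F : fieldType) r (l2 : nat) (A : 'M[F]_(dimE r)) : bool :=
  (A == one_lam F r l2 * A * one_lam F r l2) && centgmx (Sr_repr F r) A.

Definition primitive_idem (F : fieldType) r (l2 : nat) (e : 'M[F]_(dimE r)) : Prop :=
  [/\ in_Schur l2 e, e * e = e, e != 0 &
      forall e1 e2 : 'M[F]_(dimE r), in_Schur l2 e1 -> in_Schur l2 e2 ->
        e1 * e1 = e1 -> e2 * e2 = e2 -> e1 * e2 = 0 -> e2 * e1 = 0 ->
        e = e1 + e2 -> e1 = 0 \/ e2 = 0].

(* Main.v *)
Require Import Defs.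
From HB Require Import structures.
From mathcomp Require Import all_boot all_order all_algebra all_fingroup.
From mathcomp Require Import mxrepresentation zify.
Set Implicit Arguments. Unset Strict Implicit. Unset Printing Implicit Defensive.
Import GRing.Theory.
Local Open Scope ring_scope.

(* In characteristic 3 the multiplication rule gives b(3i + s) = b(3i) b(s) for
   s < 3, and the factor e_0 of e_{m,g} at u = 0 is an idempotent of the span of
   b(0), b(1), b(2) such that i |-> b(3i) e_0 again obeys the multiplication rule,
   now for m' = (m + 2 g_0) %/ 3, where g_0 is the last digit of g.  Induction on
   the number of digits shows that e = e_{m,g} is idempotent and that b(i)^3 e is
   a scalar multiple of e for all i.  Since cubing is additive on the commutative
   algebra S_F(lambda), an idempotent e1 = e1^3 = e1^3 e below e is a scalar
   multiple of e, so e is primitive.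

   Let p be a polytabloid of shape mu and q = p f^(g).  An S_r-map M^mu -> M^lambda
   sends p to a multiple of q, and <q, q> = B(m,g) <p, p>; composing the maps
   M^mu -> Y^mu -> M^lambda and back shows that B(m,g) is prime to 3.  Moreover
   q b(i) = C(g,i) C(m+g+i,i) q, whence q e = q.  If E is an idempotent of
   S_F(lambda) with image isomorphic to Y^mu, then q lies in that image, so that
   e E <> 0; primitivity of e gives e E = e and indecomposability of Y^mu gives
   E = e. *)

(** * The multiplication rule modulo 3 *)

(** One digit of Lucas's theorem. Three Pascal steps give (1 + X)^3 = 1 + X^3 modulo 3 in the form
    [bin3], which is the Pascal rule for the leading parts [a] and [b]. *)
Lemma lucas3 (a b c d : nat) : (c < 3)%N -> (d < 3)%N ->
  ('C(3 * a + c, 3 * b + d) = 'C(a, b) * 'C(c, d) %[mod 3])%N.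
Proof.
move=> c3 d3.
have bin3 n k : ('C(n.+3, k.+3) = 'C(n, k.+3) + 'C(n, k) %[mod 3])%N.
  by rewrite !binS; lia.
elim: a b => [|a IHa] [|b].
- by rewrite !muln0 !add0n bin0 mul1n.
- by rewrite muln0 add0n bin_small ?bin0n //; lia.
- have -> : (3 * a.+1 + c = (3 * a + c).+3)%N by lia.
  move: (IHa 0%N); rewrite muln0 !add0n !bin0 => <-.
  have : (d = 0 \/ d = 1 \/ d = 2)%N by lia.
  case=> [->|[->|->]]; rewrite ?bin0 ?bin1 //.
  by rewrite !binS !bin0 !bin1; lia.
- have -> : (3 * a.+1 + c = (3 * a + c).+3)%N by lia.
  have -> : (3 * b.+1 + d = (3 * b + d).+3)%N by lia.
  rewrite bin3 -modnDm.
  have -> : ((3 * b + d).+3 = 3 * b.+1 + d)%N by lia.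
  by rewrite !IHa modnDm binS mulnDl.
Qed.

Lemma lucas3_small (a c d : nat) : (c < 3)%N -> (d < 3)%N ->
  ('C(3 * a + c, d) = 'C(c, d) %[mod 3])%N.
Proof. by move=> c3 d3; have := @lucas3 a 0 c d c3 d3; rewrite muln0 bin0 mul1n. Qed.

Lemma sum_ord_mul3 (V : nmodType) n (G : nat -> V) :
  \sum_(h < 3 * n) G h = \sum_(h < n) \sum_(s < 3) G (3 * h + s)%N.
Proof.
rewrite -(big_mkord xpredT); elim: n => [|n IH]; first by rewrite big_geq // big_ord0.
rewrite big_ord_recr -IH (@big_cat_nat _ _ _ (3 * n)) //=; last by lia.
congr (_ + _); rewrite -{1}[(3 * n)%N]add0n big_addn.
rewrite (_ : 3 * n.+1 - 3 * n = 3)%N; last by lia.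
by rewrite big_mkord; apply: eq_bigr => s _; rewrite addnC.
Qed.

Lemma mulrn_mod3 (R : pzRingType) (x : R) n :
  3%:R = 0 :> R -> x *+ n = x *+ (n %% 3).
Proof.
move=> R3.
by rewrite {1}(divn_eq n 3) mulrnDr mulrnA -[x *+ _ *+ 3]mulr_natr R3 mulr0 add0r.
Qed.

Lemma mulrn_eqmod3 (R : pzRingType) (x : R) n k :
  3%:R = 0 :> R -> (n = k %[mod 3])%N -> x *+ n = x *+ k.
Proof. by move=> R3 e; rewrite mulrn_mod3 // e -mulrn_mod3. Qed.

(** The rule is imposed on all indices, so that it can be restated for the multiples of 3. The sum
    may start at h = 0, because C(h,i) C(h,j) vanishes for h < max(i,j). *)
Definition bsys (R : pzRingType) (m : nat) (b : nat -> R) :=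
  forall i j, b i * b j =
    \sum_(h < (i + j).+1) b h *+ ('C(h, i) * 'C(h, j) * 'C(m + i + j, i + j - h)).

Section Bsys.
Variables (R : pzRingType) (m : nat) (b : nat -> R).
Hypotheses (R3 : 3%:R = 0 :> R) (bs : bsys m b).

Lemma bsysC i j : b i * b j = b j * b i.
Proof.
rewrite !bs [in RHS]addnC; apply: eq_bigr => h _; congr (_ *+ _).
by rewrite [('C(h, i) * _)%N]mulnC [(m + j + i)%N]addnAC.
Qed.

Lemma bsys0l j : b 0 * b j = b j.
Proof.
rewrite bs add0n big_ord_recr /= big1 ?add0r => [|h _].
  by rewrite bin0 binn subnn bin0.
by rewrite ['C(h, j)]bin_small // muln0.
Qed.

Lemma bsys0r j : b j * b 0 = b j.
Proof. by rewrite bsysC bsys0l. Qed.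

(** By Lucas the top coefficient is 1. A term h < 3i has C(h,3i) = 0, and a term h = 3i + v with v <
    s has C(h,s) = C(v,s) = 0 modulo 3. *)
Lemma bsys_split3 i s : (s < 3)%N -> b (3 * i) * b s = b (3 * i + s).
Proof.
move=> s3; rewrite bs big_ord_recr /= big1 ?add0r => [|t _].
  rewrite subnn bin0 muln1 -[RHS]mulr1n; apply: mulrn_eqmod3 => //.
  rewrite -modnMmr lucas3_small // modnMmr binn muln1 -[X in ('C(_, X) %% 3)%N]addn0 lucas3 //.
  by rewrite binn bin0.
have [lt3|le3] := ltnP t (3 * i); first by rewrite bin_small.
rewrite -[RHS](mulr0n (b t)); apply: mulrn_eqmod3 => //.
have [v [-> vs]] : exists v, nat_of_ord t = (3 * i + v)%N /\ (v < s)%N.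
  by exists (t - 3 * i)%N; have := ltn_ord t; lia.
rewrite mulnAC -modnMmr lucas3_small //; last by lia.
by rewrite ['C(_, s)]bin_small // muln0.
Qed.

(* Elements of the span of b(0), b(1), b(2) are encoded by their coordinates, taken
   in nat modulo 3, so that identities between them can be checked by computation. *)
Definition T3 (a : nat * nat * nat) : R := b 0 *+ a.1.1 + b 1 *+ a.1.2 + b 2 *+ a.2.

(** The multiplication table with [rho] in the class of [m] modulo 3: b(0) is the unit, b(1)b(1) =
    (rho+2) b(1) + b(2), b(1)b(2) = 2 rho b(2), b(2)b(2) = C(rho+4,2) b(2). *)
Definition mul3 (rho : nat) (a c : nat * nat * nat) : nat * nat * nat :=
  ((a.1.1 * c.1.1) %% 3,
   (a.1.1 * c.1.2 + a.1.2 * c.1.1 + a.1.2 * c.1.2 * (rho + 2)) %% 3,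
   (a.1.1 * c.2 + a.2 * c.1.1 + a.1.2 * c.1.2
    + (a.1.2 * c.2 + a.2 * c.1.2) * (2 * rho) + a.2 * c.2 * 'C(rho + 4, 2)) %% 3)%N.

Lemma T3_mod a : T3 a = T3 (a.1.1 %% 3, a.1.2 %% 3, a.2 %% 3)%N.
Proof. by rewrite /T3 /=; congr (_ + _ + _); apply: mulrn_mod3. Qed.

(** The span is closed under products because the coefficients of b(3) and b(4) contain C(3,1),
    C(3,2) or C(4,2), all divisible by 3. *)
Lemma mulT3 rho a c : (m = rho %[mod 3])%N -> T3 a * T3 c = T3 (mul3 rho a c).
Proof.
move=> mrho.
have b11: b 1 * b 1 = b 1 *+ (rho + 2) + b 2.
  rewrite bs !big_ord_recr big_ord0 /= add0r !bin0n !mul0n mulr0n add0r.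
  congr (_ + _); last rewrite -[RHS]mulr1n; apply: mulrn_eqmod3 => //.
    by rewrite !binn !mul1n bin1 -addnA -modnDml mrho modnDml.
  by rewrite subnn bin0 !bin1.
have b12: b 1 * b 2 = b 2 *+ (2 * rho).
  rewrite bs !big_ord_recr big_ord0 /= add0r !bin0n !mul0n mulr0n add0r.
  rewrite mulr0n add0r.
  rewrite [b (1 + 2) *+ _](@mulrn_eqmod3 _ _ _ 0%N) ?mulr0n ?addr0 //; last first.
    by rewrite (_ : 'C(1 + 2, 1) = 3%N) // -mulnA modnMr.
  by apply: mulrn_eqmod3 => //; rewrite !binn !bin1 muln1; lia.
have b22: b 2 * b 2 = b 2 *+ 'C(rho + 4, 2).
  rewrite bs !big_ord_recr big_ord0 /= add0r !bin0n !mul0n mulr0n add0r.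
  rewrite mulr0n add0r binn !mul1n.
  rewrite [b 3 *+ _](@mulrn_eqmod3 _ _ _ 0%N) ?mulr0n ?addr0 //; last first.
    by rewrite (_ : 'C(3, 2) = 3%N) // -mulnA modnMr.
  rewrite [b (2 + 2) *+ _](@mulrn_eqmod3 _ _ _ 0%N) ?mulr0n ?addr0 //; last first.
    by rewrite (_ : 'C(2 + 2, 2) = 6%N) // subnn bin0.
  apply: mulrn_eqmod3 => //.
  have -> : (m + 2 + 2 = 3 * ((m + 4) %/ 3) + (rho + 4) %% 3)%N by lia.
  rewrite lucas3_small ?ltn_mod // -(@lucas3_small ((rho + 4) %/ 3)) ?ltn_mod //.
  by rewrite [(3 * _)%N]mulnC -divn_eq.
rewrite [RHS]/T3 /mul3 /= -!mulrn_mod3 //.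
rewrite /T3 !mulrDl !mulrDr !mulrnAl !mulrnAr !bsys0l !bsys0r [b 2 * b 1]bsysC.
rewrite b11 b12 b22 !mulrnDl -!mulrnA !mulrnDr.
set p := b 1; set q := b 2.
rewrite -!mulrnDr.
rewrite [LHS](_ : _ = b 0 *+ (c.1.1 * a.1.1) +
  (p *+ (c.1.2 * a.1.1) + p *+ (c.1.1 * a.1.2) + p *+ ((rho + 2) * (c.1.2 * a.1.2)))
  + (q *+ (c.2 * a.1.1) + q *+ (c.1.1 * a.2) + q *+ (c.1.2 * a.1.2) + 
     (q *+ (2 * rho * (c.2 * a.1.2)) + q *+ (2 * rho * (c.1.2 * a.2))) 
     + q *+ ('C(rho + 4, 2) * (c.2 * a.2)))); last first.
  rewrite !mulrnDr -!addrA; congr (_ + (_ + _)).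
  rewrite addrCA; congr (_ + _); rewrite addrCA; congr (_ + (_ + _)).
  by rewrite [RHS]addrCA; congr (_ + _); rewrite addrCA.
rewrite -!mulrnDr; congr (_ *+ _ + _ *+ _ + _ *+ _); lia.
Qed.

(* Multiplication by [b (3 * i)] only sees base-3 digits: the coefficients of
   [b (3 * h + s)] for [s = 1, 2] involve [C(rho, 3 - s)], and the hypothesis on
   [e] says that they add up to a Pascal step from [x] to [x + delta]. *)
Lemma bsys_contract x rho delta e : (rho < 3)%N -> m = (3 * x + rho)%N ->
    (forall i, GRing.comm e (b i)) -> e * e = e -> (delta < 2)%N ->
    T3 (0, 'C(rho, 2), rho)%N * e = e *+ delta ->
  bsys (x + delta) (fun i => b (3 * i) * e).
Proof.
move=> rho3 mE eC ee d2 eT i j; set n := (i + j)%N.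
have -> : b (3 * i) * e * (b (3 * j) * e) = b (3 * i) * b (3 * j) * e.
  by rewrite mulrA -[b (3 * i) * e * _]mulrA eC -!mulrA ee.
(* The top index 3n is split off, so that the remaining indices fill complete blocks 3h, 3h+1,
   3h+2. *)
rewrite bs -mulnDr -/n big_ord_recr [in RHS]big_ord_recr /= mulrDl; congr (_ + _); last first.
  rewrite mulrnAl; apply: mulrn_eqmod3 => //; rewrite !subnn !bin0 !muln1.
  rewrite -modnMm.
  have h k : ('C(3 * n, 3 * k) = 'C(n, k) %[mod 3])%N.
    by have := @lucas3 n k 0 0 isT isT; rewrite !addn0 bin0 muln1.
  by rewrite !h modnMm.
rewrite (sum_ord_mul3 n (fun h => b h *+ ('C(h, 3 * i) * 'C(h, 3 * j) *
              'C(m + 3 * i + 3 * j, 3 * n - h)))).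
rewrite mulr_suml; apply: eq_bigr => h _.
have hn := ltn_ord h.
have [y yE] : exists y, (n - h = y.+1)%N by exists (n - h).-1; lia.
rewrite big_ord_recr big_ord_recr big_ord_recr big_ord0 /= add0r.
have lu s : (s < 3)%N -> ('C(3 * h + s, 3 * i) * 'C(3 * h + s, 3 * j)
     = 'C(h, i) * 'C(h, j) %[mod 3])%N.
  move=> s3; rewrite -modnMm.
  have l k : ('C(3 * h + s, 3 * k) = 'C(h, k) %[mod 3])%N.
    by have := @lucas3 h k s 0 s3 isT; rewrite addn0 bin0 muln1.
  by rewrite !l modnMm.
have mn : (m + 3 * i + 3 * j = 3 * (x + n) + rho)%N by lia.
set A := ('C(h, i) * 'C(h, j))%N.
(* In block h the term s = 0 carries C(x+n,y+1). For s = 1, 2 the subtraction 3n - (3h+s) borrows,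
   so these terms carry C(x+n,y) times C(rho,3-s). *)
have t0 : b (3 * h + 0) *+ ('C(3 * h + 0, 3 * i) * 'C(3 * h + 0, 3 * j)
     * 'C(m + 3 * i + 3 * j, 3 * n - (3 * h + 0))) = 
     b (3 * h) *+ ('C(x + n, y.+1)) *+ A.
  rewrite addn0 -mulrnA; apply: mulrn_eqmod3 => //.
  rewrite [('C(x + n, _) * A)%N]mulnC -modnMm -{1 2}[(3 * h)%N]addn0 lu // mn.
  have -> : (3 * n - 3 * h = 3 * y.+1 + 0)%N by lia.
  by rewrite lucas3 // bin0 muln1 modnMm.
have t1 : b (3 * h + 1) *+ ('C(3 * h + 1, 3 * i) * 'C(3 * h + 1, 3 * j)
     * 'C(m + 3 * i + 3 * j, 3 * n - (3 * h + 1))) = 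
     b (3 * h) * (b 1 *+ 'C(rho, 2)) *+ 'C(x + n, y) *+ A.
  rewrite mulrnAr (bsys_split3 h (isT : 1 < 3)%N) -!mulrnA.
  apply: mulrn_eqmod3 => //.
  rewrite -modnMm lu // mn.
  have -> : (3 * n - (3 * h + 1) = 3 * y + 2)%N by lia.
  by rewrite lucas3 // modnMm; congr (_ %% 3)%N; lia.
have t2 : b (3 * h + 2) *+ ('C(3 * h + 2, 3 * i) * 'C(3 * h + 2, 3 * j)
     * 'C(m + 3 * i + 3 * j, 3 * n - (3 * h + 2))) = 
     b (3 * h) * (b 2 *+ rho) *+ 'C(x + n, y) *+ A.
  rewrite mulrnAr (bsys_split3 h (isT : 2 < 3)%N) -!mulrnA.
  apply: mulrn_eqmod3 => //.
  rewrite -modnMm lu // mn.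
  have -> : (3 * n - (3 * h + 2) = 3 * y + 1)%N by lia.
  by rewrite lucas3 // bin1 modnMm; congr (_ %% 3)%N; lia.
rewrite t0 t1 t2 -!mulrnDl -addrA -mulrnDl -mulrDr mulrnAl mulrDl !mulrnAl.
move: eT; rewrite /T3 /= mulr0n add0r => eT.
rewrite -!mulrA eT yE mulrnAr.
rewrite -[_ *+ delta *+ _]mulrnA -[_ + _]mulrnDr -mulrnA [(_ * A)%N]mulnC.
congr (_ *+ (_ * _)).
have -> : (x + delta + i + j = x + n + delta)%N by lia.
(* For [delta] = 0 there is nothing left to prove, and for [delta] = 1 this is Pascal's rule. *)
by case: delta d2 {eT} => [|[|//]] _; rewrite ?addn0 ?muln0 ?addn1 ?mul1n ?addn0 // binS.
Qed.
End Bsys.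

(** * The digit factors of e_{m,g} and the induction on digits *)

(** The factors of e_{m,g} in the coordinates of [T3], with -1 written as 2; [g] and [d] stand for
    the digits of g and m + 2g. *)
Definition fac3 (g d : nat) : nat * nat * nat :=
  match g, d with
  | 0, 0 => (1, 1, 2) | 1, 2 => (0, 2, 1)
  | 0, 1 => (1, 0, 2) | 2, 2 => (0, 0, 1)
  | 0, 2 => (1, 2, 1) | 1, 1 => (0, 1, 2)
  | _, _ => (0, 0, 0)
  end%N.

(** The leading [b 0] is the unit of the algebra, which differs from the ambient 1 in general: it is
    1_lambda at first, and becomes e_0 after a contraction. *)
Definition eprod (R : pzRingType) (N : nat) (b : nat -> R) (m g : nat) : R :=
  b 0 * \prod_(u < N)
    T3 (fun i => b (i * 3 ^ u)%N) (fac3 (digit3 g u) (digit3 (m + 2 * g) u)).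

Definition unit3 (s : nat) : nat * nat * nat := ((s == 0) : nat, (s == 1) : nat, (s == 2) : nat)%N.

Definition scale3 (c : nat) (a : nat * nat * nat) : nat * nat * nat :=
  (c * a.1.1, c * a.1.2, c * a.2)%N.

Lemma T3_unit3 (R : pzRingType) (b : nat -> R) s : (s < 3)%N -> T3 b (unit3 s) = b s.
Proof. by case: s => [|[|[|//]]] _; rewrite /T3 /= ?addr0 ?add0r. Qed.

Lemma T3_scale3 (R : pzRingType) (b : nat -> R) c a : T3 b (scale3 c a) = T3 b a *+ c.
Proof. by rewrite /T3 /= !mulrnDl -!mulrnA ![(_ * c)%N]mulnC. Qed.

Definition mod3 (a : nat * nat * nat) : nat * nat * nat :=
  (a.1.1 %% 3, a.1.2 %% 3, a.2 %% 3)%N.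

(** A finite check over the six admissible digit pairs. The parameter is m modulo 3: from d = m + 2g
    follows m = d + g modulo 3. *)
Lemma fac3_idem g d : (g <= d < 3)%N ->
  mul3 ((d + g) %% 3) (fac3 g d) (fac3 g d) = mod3 (fac3 g d).
Proof. by case: d g => [|[|[|d]]] [|[|[|g]]] //; case/andP. Qed.

(** This supplies the hypothesis on [e] in [bsys_contract]; the scalar is the carry of m + 2g out of
    the last digit. *)
Lemma fac3_contract rho g d : (g <= d < 3)%N -> rho = ((d + g) %% 3)%N ->
  mul3 rho (0, 'C(rho, 2), rho)%N (fac3 g d) = mod3 (scale3 ((rho + 2 * g) %/ 3) (fac3 g d)).
Proof. by move=> h ->; case: d g h => [|[|[|d]]] [|[|[|g]]] //; case/andP. Qed.

Lemma fac3_cube s g d : (s < 3)%N -> (g <= d < 3)%N -> exists c,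
  let r := ((d + g) %% 3)%N in
  mul3 r (unit3 s) (mul3 r (unit3 s) (mul3 r (unit3 s) (fac3 g d)))
  = mod3 (scale3 c (fac3 g d)).
Proof.
move=> s3; case: d g => [|[|[|d]]] [|[|[|g]]] //; last by case/andP.
all: case: s s3 => [|[|[|//]]] _ _; first [by exists 0%N | by exists 1%N | by exists 2%N].
Qed.

Lemma fac3_eval rho g d : (g <= d < 3)%N -> rho = ((d + g) %% 3)%N ->
  let a := fac3 g d in
  (a.1.1 + a.1.2 * (g * (rho + g + 1)) + a.2 * ('C(g, 2) * 'C(rho + g + 2, 2))
    = 1 %[mod 3])%N.
Proof. by move=> h ->; case: d g h => [|[|[|d]]] [|[|[|g]]] //; case/andP. Qed.

(** By Lucas the binomial factors into its last digit, which forces g_0 <= (m+2g)_0, and the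
    binomial of the quotients. The number m' is chosen so that these quotients are m' + 2g' and g',
    with g' the quotient of g. *)
Lemma digits3P m g : ~~ (3 %| 'C(m + 2 * g, g))%N ->
  let m' := (m %/ 3 + (m %% 3 + 2 * (g %% 3)) %/ 3)%N in
  [/\ (g %% 3 <= (m + 2 * g) %% 3)%N, (m %% 3 = ((m + 2 * g) %% 3 + g %% 3) %% 3)%N,
      ((m + 2 * g) %/ 3 = m' + 2 * (g %/ 3))%N &
      ~~ (3 %| 'C(m' + 2 * (g %/ 3), g %/ 3))%N].
Proof.
move=> nz m'.
have mg : ((m + 2 * g) %/ 3 = m' + 2 * (g %/ 3))%N by lia.
have := @lucas3 ((m + 2 * g) %/ 3) (g %/ 3) ((m + 2 * g) %% 3) (g %% 3)
  (ltn_mod _ _) (ltn_mod _ _).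
rewrite ![(3 * _)%N]mulnC -!divn_eq mg => lu.
have : ~~ (3 %| 'C(m' + 2 * (g %/ 3), g %/ 3) * 'C((m + 2 * g) %% 3, g %% 3))%N.
  by rewrite /dvdn -lu.
move=> nz'; split=> //; last 1 first.
- by apply: contra nz' => h; apply: dvdn_mulr.
- by rewrite leqNgt; apply: contra nz' => h; rewrite ['C(_, g %% 3)]bin_small ?muln0.
- lia.
Qed.

Lemma idem_mul_prod (R : pzRingType) (e : R) N (F : nat -> R) : e * e = e ->
  (forall u, GRing.comm e (F u)) ->
  e * \prod_(u < N) F u = e * \prod_(u < N) (F u * e).
Proof.
move=> ee; elim: N F => [|N IH] F eF; first by rewrite !big_ord0.
rewrite !big_ord_recl /= -[in RHS]mulrA [in RHS]mulrA eF -[in RHS]mulrA.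
rewrite [e * (e * _)]mulrA ee mulrA eF -mulrA (IH (fun u => F u.+1)) //.
Qed.

Section Eprod.
Variables (R : pzRingType) (R3 : 3%:R = 0 :> R).

Lemma T3_comm (x : R) b a : (forall i, GRing.comm x (b i)) -> GRing.comm x (T3 b a).
Proof.
by move=> xb; rewrite /T3; apply: commrD; [apply: commrD|]; apply: commrMn.
Qed.

Section Level0.
Variables (m g : nat) (b : nat -> R).
Hypotheses (bs : bsys m b) (nz : ~~ (3 %| 'C(m + 2 * g, g))%N).

Let e0 := T3 b (fac3 (g %% 3) ((m + 2 * g) %% 3)).
Let m' := (m %/ 3 + (m %% 3 + 2 * (g %% 3)) %/ 3)%N.
Let b' i := b (3 * i)%N * e0.

Let valid : (g %% 3 <= (m + 2 * g) %% 3 < 3)%N.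
Proof. by have [-> _ _ _] := digits3P nz; rewrite ltn_mod. Qed.

Let mmod : (m = ((m + 2 * g) %% 3 + g %% 3) %% 3 %[mod 3])%N.
Proof. by rewrite modn_mod; have [] := digits3P nz. Qed.

Lemma level0_comm i : GRing.comm e0 (b i).
Proof. by apply: commr_sym; apply: T3_comm => j; exact: (bsysC bs). Qed.

Lemma level0_idem : e0 * e0 = e0.
Proof. by rewrite /e0 (mulT3 R3 bs _ _ mmod) fac3_idem // [RHS](T3_mod b R3). Qed.

Lemma level0_id : b 0 * e0 = e0.
Proof. by rewrite /e0 /T3 !mulrDr !mulrnAr !(bsys0l bs). Qed.

Lemma level0_bsys : bsys m' b'.
Proof.
apply: (@bsys_contract R m b R3 bs (m %/ 3) (m %% 3)).
- by rewrite ltn_mod.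
- by rewrite mulnC -divn_eq.
- exact: level0_comm.
- exact: level0_idem.
- by have := ltn_mod g 3; have := ltn_mod m 3; lia.
- have [_ mE _ _] := digits3P nz.
  rewrite /e0 (mulT3 R3 bs _ _ (esym (modn_mod _ _))) (fac3_contract valid mE).
  by rewrite -(T3_mod b R3) T3_scale3.
Qed.

Lemma level0_cube s : (s < 3)%N -> exists c, b s * (b s * (b s * e0)) = e0 *+ c.
Proof.
move=> s3; have [c cE] := fac3_cube s3 valid; exists c.
by rewrite -(T3_unit3 b s3) /e0 !(mulT3 R3 bs _ _ mmod) cE -(T3_mod b R3) T3_scale3.
Qed.

(* The scalar by which b(i) acts on f^(g) v when e v = 0 and v has weight m + 2g. *)
Definition chi (i : nat) : nat := 'C(g, i) * 'C(m + g + i, i).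

(** Modulo 3 the scalars [chi 1] and [chi 2] depend only on the last digits of g and m, so the claim
    reduces to the finite check [fac3_eval]. *)
Lemma level0_eval y : (forall i, y * b i = y *+ chi i) -> y * e0 = y.
Proof.
move=> yb; rewrite /e0 /T3 !mulrDr !mulrnAr !yb -!mulrnA -!mulrnDr -[RHS]mulr1n.
apply: mulrn_eqmod3 => //; set a := fac3 _ _.
have [_ mE _ _] := digits3P nz.
rewrite -(fac3_eval valid mE) -/a /chi !bin0 !mul1n !bin1.
have h1 : (g * (m + g + 1) = g %% 3 * (m %% 3 + g %% 3 + 1) %[mod 3])%N.
  by rewrite -modnMm -[in RHS]modnMm modn_mod; congr ((_ * _) %% _)%N; lia.
have h2 : ('C(g, 2) * 'C(m + g + 2, 2)
    = 'C(g %% 3, 2) * 'C(m %% 3 + g %% 3 + 2, 2) %[mod 3])%N.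
  have l n : ('C(n, 2) = 'C(n %% 3, 2) %[mod 3])%N.
    by rewrite {1}(divn_eq n 3) mulnC lucas3_small // ltn_mod.
  rewrite -modnMm -[in RHS]modnMm !(l (_ + 2)%N) -(l g); congr ((_ * ('C(_, _) %% _)) %% _)%N.
  lia.
rewrite ![(_ * a.1.2)%N]mulnC ![(_ * a.2)%N]mulnC.
by rewrite -modnDm -(modnDm a.1.1) -(modnMmr a.1.2) h1 -(modnMmr a.2) h2 !modnMmr !modnDm -modnDml modnDm modnDml.
Qed.

(** The factor for digit 0 is [e0]. Being idempotent and commuting with all b(i), it can be copied
    into every later factor, which turns b(3i) into [b' i]; the new unit [b' 0] is [e0] itself. *)
Lemma eprodS N : eprod N.+1 b m g = eprod N b' m' (g %/ 3).
Proof.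
rewrite /eprod big_ord_recl /= /b' muln0 level0_id mulrA.
have dig u : (digit3 g u.+1 = digit3 (g %/ 3) u)%N.
  by rewrite /digit3 expnS divnMA.
have dig' u : (digit3 (m + 2 * g) u.+1 = digit3 (m' + 2 * (g %/ 3)) u)%N.
  by have [_ _ <- _] := digits3P nz; rewrite /digit3 expnS divnMA.
have -> : T3 (fun i => b (i * 3 ^ 0)%N) (fac3 (digit3 g 0) (digit3 (m + 2 * g) 0)) = e0.
  by rewrite /T3 /digit3 !expn0 !divn1 !muln1.
rewrite level0_id.
pose F u := T3 (fun i => b (3 * (i * 3 ^ u))%N)
  (fac3 (digit3 (g %/ 3) u) (digit3 (m' + 2 * (g %/ 3)) u)).
rewrite [X in e0 * X](eq_bigr (fun u : 'I_N => F u)); last first.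
  move=> u _; rewrite /F -dig -dig' /T3; congr (_ + _ *+ _ + _ *+ _).
    by congr b; rewrite /= /bump leq0n add1n expnS mulnCA.
  by congr b; rewrite /= /bump leq0n add1n expnS mulnCA.
rewrite idem_mul_prod ?level0_idem //; last first.
  by move=> u; apply: T3_comm => i; apply: level0_comm.
by congr (_ * _); apply: eq_bigr => u _; rewrite /F /T3 !mulrDl !mulrnAl.
Qed.

End Level0.

Lemma eprod_idl N (b : nat -> R) m g : bsys m b -> b 0 * eprod N b m g = eprod N b m g.
Proof. by move=> bs; rewrite mulrA (bsys0l bs). Qed.

Lemma eprod_idem N (b : nat -> R) m g : bsys m b -> ~~ (3 %| 'C(m + 2 * g, g))%N ->
  eprod N b m g * eprod N b m g = eprod N b m g.
Proof.
elim: N b m g => [|N IH] b m g bs nz.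
  by rewrite /eprod big_ord0 mulr1 (bsys0l bs).
have [_ _ _ nz'] := digits3P nz.
by rewrite (eprodS bs nz) IH //; apply: level0_bsys.
Qed.

Lemma eprod_cube N (b : nat -> R) m g i : bsys m b -> ~~ (3 %| 'C(m + 2 * g, g))%N ->
  (i < 3 ^ N)%N ->
  exists c, b i * (b i * (b i * eprod N b m g)) = eprod N b m g *+ c.
Proof.
elim: N b m g i => [|N IH] b m g i bs nz.
  rewrite expn0 ltnS leqn0 => /eqP->; exists 1%N.
  by rewrite /eprod big_ord0 mulr1 !(bsys0l bs).
have [_ _ _ nz'] := digits3P nz; have bs' := level0_bsys bs nz.
move=> iN; have {}iN : (i %/ 3 < 3 ^ N)%N by rewrite ltn_divLR // mulnC -expnS.
rewrite (eprodS bs nz).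
have [c cE] := IH _ _ _ _ bs' nz' iN.
have [c' cE'] := level0_cube bs nz (ltn_mod i 3).
have Qe := eprod_idl N (g %/ 3) bs'.
set Q := eprod N _ _ _ in cE Qe *.
move: cE cE' Qe (level0_comm g bs) (level0_idem bs nz) (level0_id g bs).
set e0 := T3 b _ => /= cE cE' Qe e0C e0e0 b0e0; rewrite muln0 b0e0 in Qe.
(* The part [Y] of the last digit is handled by [level0_cube], and the part [X] of the higher digits
   by the induction hypothesis for the contracted system. *)
have -> : b i = b (3 * (i %/ 3))%N * b (i %% 3)%N.
  by rewrite (bsys_split3 R3 bs) ?ltn_mod // mulnC -divn_eq.
set X := b (3 * _)%N in cE *; set Y := b (i %% 3)%N in cE' *.
have XY : X * Y = Y * X by apply: (bsysC bs).
have e0X : e0 * X = X * e0 by apply: e0C.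
exists (c * c')%N; rewrite -{1}Qe.
have -> : X * Y * (X * Y * (X * Y * (e0 * Q))) = X * (X * (X * (Y * (Y * (Y * e0)) * Q))).
  rewrite -!mulrA; congr (X * _); rewrite mulrA -XY -mulrA; congr (X * _).
  by rewrite [Y * (X * _)]mulrA -XY -mulrA mulrA -XY -mulrA; congr (X * _); rewrite !mulrA.
rewrite cE' mulrnAl !mulrnAr mulrnA -cE; congr (_ *+ _).
have eX z : e0 * z = z -> e0 * (X * z) = X * z.
  by move=> ez; rewrite mulrA e0X -mulrA ez.
by rewrite -!mulrA !(eX, Qe).
Qed.

Lemma eprod_eval N (b : nat -> R) m g y : bsys m b -> ~~ (3 %| 'C(m + 2 * g, g))%N ->
  (forall i, y * b i = y *+ chi m g i) -> y * eprod N b m g = y.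
Proof.
elim: N b m g => [|N IH] b m g bs nz yb.
  by rewrite /eprod big_ord0 mulr1 yb /chi !bin0.
have [le_d mE _ nz'] := digits3P nz.
rewrite (eprodS bs nz) IH //; first exact: level0_bsys.
move=> i /=; rewrite mulrA yb mulrnAl (level0_eval nz yb).
apply: mulrn_eqmod3 => //; rewrite /chi -modnMm -[in RHS]modnMm.
set m' := (m %/ 3 + (m %% 3 + 2 * (g %% 3)) %/ 3)%N.
(* Since g_0 <= (m+2g)_0, the last digit of m + g is their difference, without a borrow. Lucas then
   identifies [chi] at 3i with [chi] at i for the contracted parameters. *)
have -> : (m + g + 3 * i = 3 * (m' + g %/ 3 + i) + ((m + 2 * g) %% 3 - g %% 3))%N.
  by rewrite /m'; lia.
rewrite {1}(divn_eq g 3) [(_ * 3)%N]mulnC -[(3 * i)%N]addn0 !lucas3 ?ltn_mod //; last by lia.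
by rewrite !bin0 !muln1.
Qed.

End Eprod.

(** * Divided powers as matrices *)

Lemma card_between (T : finType) (A B : {set T}) n : A \subset B -> (#|A| <= n)%N ->
  #|[set V : {set T} | [&& A \subset V, V \subset B & #|V| == n]]|
  = 'C(#|B| - #|A|, n - #|A|).
Proof.
move=> AB An; rewrite -(cardsDS AB) -cards_draws.
have inj : {in [set V : {set T} | (V \subset B :\: A) & (#|V| == n - #|A|)%N] &,
            injective (setU A)}.
  move=> V V'; rewrite !inE !subsetD => /andP[/andP[_ dV] _] /andP[/andP[_ dV'] _] e.
  have K (X : {set T}) : [disjoint X & A] -> (A :|: X) :\: A = X.
    by move=> dX; rewrite setDUl setDv set0U; apply/setDidPl.
  by rewrite -(K V) // e K.
rewrite -(card_in_imset inj); apply: eq_card => V; rewrite !inE.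
apply/and3P/imsetP => [[AV VB /eqP Vn]|[X]].
  exists (V :\: A); last by rewrite -{1}(setID V A) (setIidPr AV).
  by rewrite inE setSD // cardsDS // Vn eqxx.
rewrite inE subsetD => /andP[/andP[XB dX] /eqP Xn] ->.
rewrite subsetUl subUset AB XB cardsU disjoint_setI0 1?disjoint_sym // cards0.
by rewrite Xn subn0 subnKC.
Qed.

(** Here a, a', c are the sizes of two sets and of their intersection. The left side counts
    supersets of the union of size a + j, the right side weights subsets of the intersection. With N
    + c the size of the complement of the union, this is Vandermonde for C(N+c, K). *)
Lemma vandermonde_shift r a a' c i j :
  (c <= a)%N -> (c <= a')%N -> (a + j = a' + i)%N -> (a + a' - c <= r)%N ->
  (2 * a + j <= r + i)%N ->
  (if a + a' - c <= a + j then 'C(r - (a + a' - c), a + j - (a + a' - c)) else 0)%N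
  = (\sum_(t < (i + j).+1 | (t <= i) && (t <= j))
      'C(r + i - (2 * a + j), t) * (if i - t <= a then 'C(c, a - (i - t)) else 0))%N.
Proof.
move=> ca ca' aj Ur Nr; set N := (r + i - _)%N.

have [le|gt] := leqP (a + a' - c) (a + j); last first.
  rewrite big1 // => t /andP[ti tj]; case: ifP => [h|_]; last exact: muln0.
  by rewrite ['C(c, _)]bin_small ?muln0 //; lia.
have -> : (r - (a + a' - c) = N + c)%N by rewrite /N; lia.
set K := (c + i - a)%N.
have -> : (a + j - (a + a' - c) = K)%N by rewrite /K; lia.
rewrite -binomial.Vandermonde (big_ord_widen (i + j).+1 (fun t => 'C(N, t) * 'C(c, K - t))%N); last first.
  by rewrite /K; lia.
rewrite big_mkcond [RHS]big_mkcond; apply: eq_bigr => t _.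
have [tK|Kt] := leqP t K.
  rewrite ltnS tK (_ : (t <= i)%N && (t <= j)%N); last by move: tK; rewrite /K; lia.
  congr (_ * _)%N; case: ifP => h.
    by rewrite -bin_sub; [congr 'C(_, _); move: tK; rewrite /K|move: tK; rewrite /K]; lia.
  by rewrite bin_small //; rewrite /K; lia.
rewrite ltnS leqNgt Kt /=; case: ifP => // /andP[ti tj]; case: ifP => [h|_]; last by rewrite muln0.
by rewrite ['C(c, _)]bin_small ?muln0 //; move: Kt; rewrite /K; lia.
Qed.

Section Operators.
Variables (F : fieldType) (r : nat).
Local Notation W := (word r).

Lemma wmxE (c : W -> W -> F) w w' : wmx c (enum_rank w) (enum_rank w') = c w w'.
Proof. by rewrite mxE !enum_rankK. Qed.

Lemma eq_wmx (c d : W -> W -> F) : (forall w w', c w w' = d w w') -> wmx c = wmx d.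
Proof. by move=> cd; apply/matrixP=> i j; rewrite !mxE cd. Qed.

Lemma wmx_eta (A : 'M[F]_(dimE r)) :
  A = wmx (fun w w' => A (enum_rank w) (enum_rank w')).
Proof. by apply/matrixP=> i j; rewrite !mxE !enum_valK. Qed.

Lemma sum_dimE (V : nmodType) (G : 'I_(dimE r) -> V) :
  \sum_i G i = \sum_(w : W) G (enum_rank w).
Proof. by rewrite (reindex (@enum_rank W)) //; apply/onW_bij/enum_rank_bij. Qed.

Lemma mul_wmx (c d : W -> W -> F) :
  wmx c *m wmx d = wmx (fun w w' => \sum_v c w v * d v w').
Proof.
apply/matrixP=> i j; rewrite !mxE sum_dimE; apply: eq_bigr => v _.
by rewrite !mxE enum_rankK.
Qed.

Lemma tr_wmx (c : W -> W -> F) : (wmx c)^T = wmx (fun w w' => c w' w).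
Proof. by apply/matrixP=> i j; rewrite !mxE. Qed.

Lemma mulrn_wmx (c : W -> W -> F) n : wmx c *+ n = wmx (fun w w' => c w w' *+ n).
Proof. by apply/matrixP=> i j; rewrite mulmxnE !mxE. Qed.

Lemma sum_wmx I (s : seq I) P (c : I -> W -> W -> F) :
  \sum_(i <- s | P i) wmx (c i) = wmx (fun w w' => \sum_(i <- s | P i) c i w w').
Proof. by apply/matrixP=> i j; rewrite summxE !mxE; apply: eq_bigr => k _; rewrite mxE. Qed.

Lemma twos_inj : injective (@twos r).
Proof. by move=> w v /setP wv; apply/ffunP=> k; have := wv k; rewrite !inE. Qed.

Definition word_of (A : {set 'I_r}) : W := [ffun k => k \in A].

Lemma twosK : cancel (@twos r) word_of.
Proof. by move=> w; apply/ffunP=> k; rewrite ffunE inE. Qed.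

Lemma word_ofK : cancel word_of (@twos r).
Proof. by move=> A; apply/setP=> k; rewrite inE ffunE. Qed.

Lemma sum_word (P : pred {set 'I_r}) :
  \sum_(v : W) ((P (twos v) : bool)%:R : F) = (#|[set A | P A]|)%:R.
Proof.
rewrite -sum1dep_card natr_sum (reindex (@twos r)) /=; last first.
  by exists word_of => [w _|A _]; [apply: twosK | apply: word_ofK].
by rewrite [RHS]big_mkcond; apply: eq_bigr => v _; case: (P _).
Qed.

Lemma mulnb_natr (b1 b2 : bool) : (b1%:R * b2%:R : F) = (b1 && b2)%:R.
Proof. by rewrite -natrM mulnb. Qed.

Lemma tr_e_div i : (e_div F r i)^T = f_div F r i.
Proof. by rewrite tr_wmx. Qed.

Lemma mul_one_lam l (c : W -> W -> F) :
  one_lam F r l *m wmx c = wmx (fun w w' => (#|twos w| == l)%:R * c w w').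
Proof.
rewrite mul_wmx; apply: eq_wmx => w w'; rewrite (bigD1 w) //= eqxx.
by rewrite big1 ?addr0 // => v /negPf vw; rewrite eq_sym vw mul0r.
Qed.

Lemma mul_wmx_one_lam l (c : W -> W -> F) :
  wmx c *m one_lam F r l = wmx (fun w w' => c w w' * (#|twos w'| == l)%:R).
Proof.
rewrite mul_wmx; apply: eq_wmx => w w'; rewrite (bigD1 w') //= eqxx.
by rewrite big1 ?addr0 // => v /negPf vw; rewrite vw mulr0.
Qed.

Lemma one_lam_idem l : one_lam F r l *m one_lam F r l = one_lam F r l.
Proof.
rewrite mul_one_lam; apply: eq_wmx => w w'; rewrite mulnb_natr.
by congr (_%:R); case: (_ == l); rewrite ?andbF.
Qed.

Lemma one_lam_e l i : one_lam F r l *m e_div F r i *m one_lam F r (l - i)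
  = one_lam F r l *m e_div F r i.
Proof.
rewrite mul_one_lam mul_wmx_one_lam; apply: eq_wmx => w w'; rewrite !mulnb_natr.
congr (_%:R); case: eqP => //= ->; case: (_ \subset _) => //=.
by case: eqP => //= ->; rewrite addnK eqxx.
Qed.

Lemma one_lam_ef l i : one_lam F r l *m e_div F r i *m f_div F r i *m one_lam F r l
  = one_lam F r l *m e_div F r i *m f_div F r i.
Proof.
rewrite -one_lam_e mul_one_lam mul_wmx_one_lam mul_wmx mul_wmx_one_lam.
apply: eq_wmx => w w'; rewrite mulr_suml; apply: eq_bigr => v _.
rewrite !mulnb_natr; congr ((nat_of_bool _)%:R).
by lia.
Qed.

Lemma mul_e_div i j :
  e_div F r i *m e_div F r j = e_div F r (i + j) *+ 'C(i + j, j).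
Proof.
rewrite mul_wmx mulrn_wmx; apply: eq_wmx => w w'.
under eq_bigr do rewrite mulnb_natr.
rewrite (sum_word (fun V => ((V \subset twos w) && (#|twos w| == #|V| + i)%N)
  && ((twos w' \subset V) && (#|V| == #|twos w'| + j)%N))) -mulrnA.
have [/andP[w'w /eqP ww']|h] :=
  boolP ((twos w' \subset twos w) && (#|twos w| == #|twos w'| + (i + j))%N).
  have -> : 'C(i + j, j) = 'C(#|twos w| - #|twos w'|, #|twos w'| + j - #|twos w'|).
    by congr 'C(_, _); lia.
  rewrite mul1n -card_between ?leq_addr //; congr (_%:R); apply: eq_card => V.
  by rewrite !inE; lia.
rewrite mul0n eq_card0 // => V; rewrite !inE; apply/negP.
case/andP=> /andP[Vw wV] /andP[w'V Vw']; have := subset_trans w'V Vw; lia.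
Qed.

Lemma mul_f_div i j :
  f_div F r i *m f_div F r j = f_div F r (i + j) *+ 'C(i + j, i).
Proof.
by rewrite -!tr_e_div -trmx_mul mul_e_div addnC -raddfMn.
Qed.

(** The commutation rule for divided powers on a weight space. An entry on the left counts common
    supersets of two words, an entry on the right common subsets; [vandermonde_shift] compares them.
    The bound keeps the subtraction in the binomial from truncating. *)
Lemma f_div_e_div a i j : (2 * a + j <= r + i)%N ->
  one_lam F r a *m f_div F r j *m e_div F r i =
  \sum_(t < (i + j).+1 | (t <= i)%N && (t <= j)%N)
    (one_lam F r a *m e_div F r (i - t) *m f_div F r (j - t))
      *+ 'C(r + i - (2 * a + j), t).
Proof.
move=> Nr; rewrite -mulmxA mul_wmx mul_one_lam.
transitivity (\sum_(t < (i + j).+1 | (t <= i)%N && (t <= j)%N)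
    wmx (fun w w' : W => ((#|twos w| == a)%:R * (\sum_v
     ((twos v \subset twos w) && (#|twos w| == #|twos v| + (i - t))%N)%:R *
      ((twos v \subset twos w') && (#|twos w'| == #|twos v| + (j - t))%N)%:R))
      *+ 'C(r + i - (2 * a + j), t) : F)); last first.
  by apply: eq_bigr => t _; rewrite -[in RHS]mulmxA mul_wmx mul_one_lam mulrn_wmx.
rewrite sum_wmx; apply: eq_wmx => w w'.
case: (#|twos w| =P a) => [wa|_]; last first.
  by rewrite mul0r big1 // => t _; rewrite mul0r mul0rn.
rewrite mul1r; under eq_bigr do rewrite mulnb_natr.
rewrite (sum_word (fun V => ((twos w \subset V) && (#|V| == #|twos w| + j)%N)
  && ((twos w' \subset V) && (#|V| == #|twos w'| + i)%N))).
under [RHS]eq_bigr => t _.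
  rewrite mul1r; under eq_bigr do rewrite mulnb_natr.
  rewrite (sum_word (fun V => ((V \subset twos w) && (#|twos w| == #|V| + (i - t))%N)
    && ((V \subset twos w') && (#|twos w'| == #|V| + (j - t))%N))) -mulrnA.
  over.
rewrite -natr_sum; congr (_%:R).
have [aj|aj] := eqVneq (a + j)%N (#|twos w'| + i)%N; last first.
  rewrite eq_card0 ?big1 // => [t ti|V]; last by rewrite !inE; lia.
  by rewrite eq_card0 ?mul0n // => V; rewrite !inE; lia.
have cU := cardsUI (twos w) (twos w').
have cI1 := subset_leq_card (subsetIl (twos w) (twos w')).
have cI2 := subset_leq_card (subsetIr (twos w) (twos w')).
have cUr := subset_leq_card (subsetT (twos w :|: twos w')).
rewrite cardsT card_ord in cUr.
have UE : #|twos w :|: twos w'| = (a + #|twos w'| - #|twos w :&: twos w'|)%N by lia.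
transitivity (if (a + #|twos w'| - #|twos w :&: twos w'| <= a + j)%N then
  'C(r - (a + #|twos w'| - #|twos w :&: twos w'|),
     a + j - (a + #|twos w'| - #|twos w :&: twos w'|)) else 0%N).
  rewrite -UE; case: ifP => le.
    have rT : r = #|[set: 'I_r]| by rewrite cardsT card_ord.
    rewrite [X in 'C(X - _, _)]rT -card_between ?subsetT //.
    by apply: eq_card => V; rewrite !inE subUset subsetT; lia.
  apply: eq_card0 => V; rewrite !inE; apply/negP => /andP[/andP[h1 h2] /andP[h3 h4]].
  have : twos w :|: twos w' \subset V by rewrite subUset h1.
  by move/subset_leq_card; lia.
rewrite (@vandermonde_shift r _ _ _ i) //; [|lia..].
apply: eq_bigr => t /andP[ti tj]; rewrite mulnC; congr (_ * _)%N; case: ifP => le.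
  have -> : 'C(#|twos w :&: twos w'|, a - (i - t))
     = 'C(#|twos w :&: twos w'| - #|@set0 'I_r|, a - (i - t) - #|@set0 'I_r|).
    by rewrite cards0 !subn0.
  rewrite -card_between ?sub0set ?cards0 //.
  by apply: eq_card => V; rewrite !inE sub0set subsetI; lia.
by apply/esym/eq_card0 => V; rewrite !inE; lia.
Qed.

End Operators.

(** * Endomorphisms of the permutation modules *)

(** The convention b(i) = 0 for i > l is automatic: e^(i) kills every word with fewer than i entries
    2. *)
Lemma bbE (F : fieldType) r l i :
  bb F r l i = one_lam F r l *m e_div F r i *m f_div F r i.
Proof.
rewrite /bb one_lam_ef; case: leqP => // li.
rewrite mul_one_lam -[LHS](mul0mx _ (f_div F r i)); congr (_ *m _).
apply/matrixP=> u v; rewrite !mxE mulnb_natr (_ : _ && _ = false) //; lia.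
Qed.

(** In b(i) b(j) the inner pair f^(i), e^(j) is commuted on the words with l2 - i entries 2;
    neighbouring divided powers then merge, and the t-th term becomes a multiple of b(i+j-t). *)
Lemma bsys_bb (F : fieldType) r l1 l2 : (l2 <= l1)%N -> (l1 + l2)%N = r ->
  bsys (l1 - l2) (bb F r l2).
Proof.
move=> hl hr i j.
have [li|il] := ltnP l2 i.
  rewrite {1}/bb leqNgt li /= mul0r big1 // => h _.
  have [hi|ih] := ltnP h i; first by rewrite bin_small.
  by rewrite /bb leqNgt (leq_trans li ih) mul0rn.
rewrite -[LHS]/(_ *m _) [bb F r l2 j]bbE.
rewrite !mulmxA /bb il -(mulmxA _ (one_lam F r l2) (one_lam F r l2)) one_lam_idem one_lam_ef.
rewrite -one_lam_e -!mulmxA (mulmxA _ (f_div F r i)) (mulmxA _ (e_div F r j)).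
rewrite f_div_e_div; last by lia.
rewrite mulmx_suml !mulmx_sumr big_mkcond.
rewrite [RHS](reindex_inj rev_ord_inj) /=; rewrite addnC; apply: eq_bigr => t _.
rewrite /= subSS.
rewrite -/(bb F r l2 (i + j - t)) bbE; have tij := ltn_ord t.
(* For t > j or t > i the commutation rule has no term, and on the other side C(h,i) or C(h,j)
   vanishes at h = i + j - t. *)
case: ifP => [/andP[tj ti]|h]; last first.
  have [tj|jt] := leqP t j; last by rewrite ['C(_, i)]bin_small ?mulr0n //; lia.
  by rewrite ['C(_, j)]bin_small ?muln0 ?mulr0n //; lia.
have [eij fij] : (i + (j - t) = i + j - t)%N /\ (i - t + j = i + j - t)%N by lia.
rewrite -!scaler_nat -!scalemxAl -!scalemxAr !mulmxA one_lam_e.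
rewrite -(mulmxA _ (e_div F r i)) mul_e_div eij.
rewrite -(mulmxA _ (f_div F r (i - t))) mul_f_div fij.
rewrite -!scaler_nat -!scalemxAr -!scalemxAl !scalerA -!natrM; congr (_%:R *: _).
have -> : 'C(i + j - t, j - t) = 'C(i + j - t, i).
  by rewrite -bin_sub; [congr 'C(_, _)|]; lia.
have -> : 'C(i + j - t, i - t) = 'C(i + j - t, j).
  by rewrite -bin_sub; [congr 'C(_, _)|]; lia.
have -> : (r + j - (2 * (l2 - i) + i) = l1 - l2 + i + j)%N by lia.
have -> : (i + j - (i + j - t) = t)%N by lia.
by lia.
Qed.

Section Intertwiners.
Variables (F : fieldType) (r : nat).
Local Notation W := (word r).

(** The invariants fix how often each of the four letter pairs occurs, and two words in these pairs
    with equal multiplicities are permutations of each other. *)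
Lemma wact_exists (w1 v1 w2 v2 : W) :
  #|twos w1| = #|twos w2| -> #|twos v1| = #|twos v2| ->
  #|twos w1 :&: twos v1| = #|twos w2 :&: twos v2| ->
  exists s : 'S_r, wact w1 s = w2 /\ wact v1 s = v2.
Proof.
move=> ew ev ewv.
pose c w v := [tuple (w i, v i) | i < r] : r.-tuple (bool * bool).
have cnt (w v : W) x : count_mem x (c w v) = #|[set i | (w i == x.1) && (v i == x.2)]|.
  by rewrite /= count_map -sum1_count -sum1dep_card big_enum_cond.
have /tuple_permP[s sE] : perm_eq (c w2 v2) (c w1 v1).
  apply/allP=> x _ /=; rewrite !cnt.
  have cUI (w v : W) := cardsUI (twos w) (twos v).
  have cD (w v : W) := cardsID (twos v) (twos w).
  have cC (w v : W) := cardsC (twos w :|: twos v).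
  case: x => [[] []] /=.
  - have h (w v : W) : #|[set i | (w i == true) && (v i == true)]| = #|twos w :&: twos v|.
      by apply: eq_card => i; rewrite !inE !eqb_id.
    by rewrite !h ewv.
  - have h (w v : W) : #|[set i | (w i == true) && (v i == false)]| = #|twos w :\: twos v|.
      by apply: eq_card => i; rewrite !inE eqb_id eqbF_neg andbC.
    by rewrite !h; have := cD w1 v1; have := cD w2 v2; lia.
  - have h (w v : W) : #|[set i | (w i == false) && (v i == true)]| = #|twos v :\: twos w|.
      by apply: eq_card => i; rewrite !inE eqb_id eqbF_neg.
    rewrite !h; have := cD v1 w1; have := cD v2 w2.
    by rewrite [twos v1 :&: _]setIC [twos v2 :&: _]setIC ewv; lia.
  - have h (w v : W) : #|[set i | (w i == false) && (v i == false)]| = #|~: (twos w :|: twos v)|.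
      by apply: eq_card => i; rewrite !inE !eqbF_neg negb_or.
    rewrite !h; have := cC w1 v1; have := cC w2 v2; have := cUI w1 v1; have := cUI w2 v2.
    lia.
by exists s^-1%g; split; apply/ffunP=> i; rewrite ffunE invgK;
  move/(congr1 (fun t : seq _ => nth (false, false) t i)): sE;
  rewrite -!tnth_nth !tnth_mktuple => -[].
Qed.

Lemma twos_wact (w : W) s : twos (wact w s) = s @: twos w.
Proof.
apply/setP=> i; rewrite !inE ffunE; apply/idP/imsetP => [wi|[j]].
  by exists ((s^-1)%g i); rewrite ?inE // permKV.
by rewrite inE => wj ->; rewrite permK.
Qed.

Lemma wact_inj s : injective (fun w : W => wact w s).
Proof.
by move=> w v /(congr1 (fun u => wact u s^-1%g)); rewrite !wactM mulgV !wact1.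
Qed.

Lemma intertwiner_entry (X : 'M[F]_(dimE r)) :
  (forall s, X *m Sr_mx F s = Sr_mx F s *m X) ->
  forall s (w v : W), X (enum_rank (wact w s)) (enum_rank (wact v s))
    = X (enum_rank w) (enum_rank v).
Proof.
move=> XC s w v.
have := XC s; rewrite {1 2}[X]wmx_eta !mul_wmx.
move/(congr1 (fun M : 'M_ _ => M (enum_rank w) (enum_rank (wact v s)))).
rewrite !wmxE.
rewrite (bigD1 v) //= eqxx mulr1 big1 ?addr0 => [|u /negPf uv]; last first.
  by rewrite (inj_eq (@wact_inj s)) eq_sym uv mulr0.
rewrite (bigD1 (wact w s)) //= eqxx mul1r big1 ?addr0 => [->//|u /negPf uv].
by rewrite uv mul0r.
Qed.

(** The general form of an S_r-map between the spaces of words with k and with l entries 2: an orbit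
    on pairs of such words is determined by the size of the intersection. *)
Definition orbmx (k l : nat) (a : nat -> F) : 'M[F]_(dimE r) :=
  wmx (fun w v : W => ((#|twos w| == k) && (#|twos v| == l))%:R
                      * a #|twos w :&: twos v|).

Lemma intertwiner_orbmx k l (X : 'M[F]_(dimE r)) :
  (forall s, X *m Sr_mx F s = Sr_mx F s *m X) ->
  one_lam F r k *m X *m one_lam F r l = X -> exists a, X = orbmx k l a.
Proof.
move=> XC X1.
(* The entry at any pair of intersection size j; the default 0 covers sizes that do not occur. *)
pose a j := if [pick p : W * W | [&& #|twos p.1| == k, #|twos p.2| == l
   & #|twos p.1 :&: twos p.2| == j]] is Some p
   then X (enum_rank p.1) (enum_rank p.2) else 0.
exists a; rewrite -{1}X1 [X in _ *m X *m _]wmx_eta mul_one_lam mul_wmx_one_lam.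
apply: eq_wmx => w v; rewrite mulrAC mulnb_natr /a.
case: eqP => //= wk; last by rewrite !mul0r.
case: eqP => //= vl; last by rewrite !mul0r.
case: pickP => [[w' v'] /and3P[/= /eqP wk' /eqP vl' /eqP wv']|/(_ (w, v))]; last first.
  by rewrite /= wk vl !eqxx.
have [||//|s [<- <-]] := @wact_exists w' v' w v; rewrite ?wk ?vl //.
by rewrite intertwiner_entry.
Qed.

Lemma orbmx_intertwiner k l a s :
  orbmx k l a *m Sr_mx F s = Sr_mx F s *m orbmx k l a.
Proof.
rewrite !mul_wmx; apply: eq_wmx => w v.
pose v' := wact v s^-1%g.
have vE : v = wact v' s by rewrite wactM mulVg wact1.
rewrite (bigD1 v') //= -vE eqxx mulr1 big1 ?addr0 => [|u /negPf uv]; last first.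
  by rewrite (_ : (v == _) = false) ?mulr0 // {1}vE (inj_eq (@wact_inj s)) eq_sym.
rewrite (bigD1 (wact w s)) //= eqxx mul1r big1 ?addr0 => [|u /negPf uv]; last first.
  by rewrite uv mul0r.
rewrite [in RHS]vE !twos_wact -imsetI; last by move=> x y _ _; apply: perm_inj.
by rewrite !card_imset //; apply: perm_inj.
Qed.

Lemma one_orbmx k l a : one_lam F r k *m orbmx k l a = orbmx k l a.
Proof.
by rewrite mul_one_lam; apply: eq_wmx => w v; rewrite mulrA mulnb_natr andbA andbb.
Qed.

Lemma orbmx_one k l a : orbmx k l a *m one_lam F r l = orbmx k l a.
Proof.
rewrite mul_wmx_one_lam; apply: eq_wmx => w v.
by rewrite mulrAC mulnb_natr -andbA andbb.
Qed.

Lemma tr_orbmx k l a : (orbmx k l a)^T = orbmx l k a.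
Proof. by rewrite tr_wmx; apply: eq_wmx => w v; rewrite andbC setIC. Qed.

Lemma one_e_orbmx k i : (i <= k)%N ->
  one_lam F r k *m e_div F r i = orbmx k (k - i)%N (fun j => (j == (k - i)%N)%:R).
Proof.
move=> ik; rewrite mul_one_lam; apply: eq_wmx => w v; rewrite !mulnb_natr.
congr ((nat_of_bool _)%:R).
have c1 : (twos v \subset twos w) = (#|twos w :&: twos v| == #|twos v|).
  by rewrite (sameP setIidPr eqP) eqEcard subsetIr /= eqn_leq (subset_leq_card (subsetIr _ _)).
by rewrite c1; lia.
Qed.

Lemma one_f_orbmx k i :
  one_lam F r k *m f_div F r i = orbmx k (k + i)%N (fun j => (j == k)%:R).
Proof.
rewrite mul_one_lam; apply: eq_wmx => w v; rewrite !mulnb_natr.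
congr ((nat_of_bool _)%:R).
have c1 : (twos w \subset twos v) = (#|twos w :&: twos v| == #|twos w|).
  by rewrite (sameP setIidPl eqP) eqEcard subsetIl /= eqn_leq (subset_leq_card (subsetIl _ _)).
by rewrite c1; lia.
Qed.

(** An intermediate word is a common subset of size l - i of the two words. *)
Lemma bb_orbmx l i : (i <= l)%N -> bb F r l i = orbmx l l (fun j => 'C(j, l - i)%:R).
Proof.
move=> il; rewrite bbE -one_lam_ef -one_lam_e mul_one_lam mul_wmx_one_lam.
rewrite mul_wmx mul_wmx_one_lam; apply: eq_wmx => w v.
have [wl|] := boolP (#|twos w| == l); last first.
  by move=> _; rewrite mul0r big1 ?mul0r // => u _; rewrite !mul0r.
have [vl|_] := boolP (#|twos v| == l); last by rewrite mulr0 mul0r.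
rewrite mulr1 mul1r; under eq_bigr do rewrite mul1r !mulnb_natr.
rewrite (sum_word F (fun V => ((V \subset twos w) && (#|twos w| == #|V| + i)%N)
  && (#|V| == l - i)%N && ((V \subset twos v) && (#|twos v| == #|V| + i)%N))).
have -> : 'C(#|twos w :&: twos v|, l - i)
     = 'C(#|twos w :&: twos v| - #|@set0 'I_r|, l - i - #|@set0 'I_r|).
  by rewrite cards0 !subn0.
rewrite -card_between ?sub0set ?cards0 //; congr (_%:R).
by apply: eq_card => V; rewrite !inE sub0set subsetI; lia.
Qed.

(** The matrix of the C(j,i) is triangular with diagonal 1, so it can be inverted over any field. *)
Lemma binomial_interpolation (a : nat -> F) l :
  exists c : nat -> F, forall j, (j <= l)%N -> a j = \sum_(i < l.+1) c i * 'C(j, i)%:R.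
Proof.
elim: l => [|l [c cE]].
  exists a => j; rewrite leqn0 => /eqP->.
  by rewrite big_ord_recl big_ord0 bin0 mulr1 addr0.
exists (fun i => if (i <= l)%N then c i else a l.+1 - \sum_(i < l.+1) c i * 'C(l.+1, i)%:R).
move=> j jl; rewrite big_ord_recr /= ltnn.
under eq_bigr => i _ do rewrite -ltnS ltn_ord.
move: jl; rewrite leq_eqVlt ltnS => /orP[/eqP->|jl].
  by rewrite binn mulr1 addrC subrK.
by rewrite bin_small ?mulr0 ?addr0 // cE.
Qed.

Lemma in_SchurP l (X : 'M[F]_(dimE r)) :
  reflect (exists a, X = orbmx l l a) (in_Schur l X).
Proof.
apply: (iffP andP) => [[/eqP X1 /centgmxP XC]|[a ->]].
  by apply: intertwiner_orbmx => // s; apply: XC; rewrite inE.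
split; first by apply/eqP; rewrite -mulmxE one_orbmx orbmx_one.
by apply/centgmxP=> s _; apply: orbmx_intertwiner.
Qed.

Lemma in_Schur_span l (X : 'M[F]_(dimE r)) : in_Schur l X ->
  exists c : nat -> F, X = \sum_(i < l.+1) c i *: bb F r l i.
Proof.
case/in_SchurP=> a ->; have [c cE] := binomial_interpolation a l.
(* The indices are reversed because C(j,i) is the function belonging to b(l-i). *)
exists (fun i => c (l - i)%N); rewrite (reindex_inj rev_ord_inj) /=.
have -> : \sum_(i < l.+1) c (l - (l.+1 - i.+1))%N *: bb F r l (l.+1 - i.+1)
  = \sum_(i < l.+1) wmx (fun w v : W => c i * (((#|twos w| == l) && (#|twos v| == l))%:R
                      * 'C(#|twos w :&: twos v|, i)%:R)).
  apply: eq_bigr => i _; have il := ltn_ord i.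
  rewrite subSS bb_orbmx ?leq_subr // subKn //.
  by apply/matrixP=> u v; rewrite !mxE.
rewrite sum_wmx; apply: eq_wmx => w v.
case: eqP => [wl|_] /=; last by rewrite mul0r big1 // => i _; rewrite mul0r mulr0.
case: eqP => [vl|_] /=; last by rewrite mul0r big1 // => i _; rewrite mul0r mulr0.
rewrite mul1r cE; last by rewrite -wl subset_leq_card ?subsetIl.
by apply: eq_bigr => i _; rewrite mul1r.
Qed.

Lemma in_Schur_idl l (X : 'M[F]_(dimE r)) : in_Schur l X -> one_lam F r l *m X = X.
Proof. by case/in_SchurP=> a ->; apply: one_orbmx. Qed.

Lemma in_Schur_idr l (X : 'M[F]_(dimE r)) : in_Schur l X -> X *m one_lam F r l = X.
Proof. by case/in_SchurP=> a ->; apply: orbmx_one. Qed.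

Lemma in_Schur_comm l (X : 'M[F]_(dimE r)) s : in_Schur l X ->
  X *m Sr_mx F s = Sr_mx F s *m X.
Proof. by case/in_SchurP=> a ->; apply: orbmx_intertwiner. Qed.

Lemma in_Schur_intro l (X : 'M[F]_(dimE r)) :
  one_lam F r l *m X = X -> X *m one_lam F r l = X ->
  (forall s, X *m Sr_mx F s = Sr_mx F s *m X) -> in_Schur l X.
Proof.
move=> oX Xo XC; apply/andP; split; first by rewrite -!mulmxE oX Xo.
by apply/centgmxP=> s _; apply: XC.
Qed.

Lemma in_Schur_mul l (X Y : 'M[F]_(dimE r)) :
  in_Schur l X -> in_Schur l Y -> in_Schur l (X *m Y).
Proof.
move=> hX hY; apply: in_Schur_intro => [||s].
- by rewrite mulmxA (in_Schur_idl hX).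
- by rewrite -mulmxA (in_Schur_idr hY).
- by rewrite -mulmxA (in_Schur_comm s hY) mulmxA (in_Schur_comm s hX) mulmxA.
Qed.

Lemma in_Schur_sub l (X Y : 'M[F]_(dimE r)) :
  in_Schur l X -> in_Schur l Y -> in_Schur l (X - Y).
Proof.
move=> hX hY; apply: in_Schur_intro => [||s].
- by rewrite mulmxBr (in_Schur_idl hX) (in_Schur_idl hY).
- by rewrite mulmxBl (in_Schur_idr hX) (in_Schur_idr hY).
- by rewrite mulmxBl mulmxBr (in_Schur_comm s hX) (in_Schur_comm s hY).
Qed.

(** Every element of the algebra is a symmetric matrix, so transposing a product reverses it without
    changing it. *)
Lemma in_Schur_mulC l (X Y : 'M[F]_(dimE r)) :
  in_Schur l X -> in_Schur l Y -> X *m Y = Y *m X.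
Proof.
move=> hX hY.
have trS (Z : 'M[F]_(dimE r)) : in_Schur l Z -> Z^T = Z.
  by case/in_SchurP=> a ->; apply: tr_orbmx.
by rewrite -(trS _ (in_Schur_mul hX hY)) trmx_mul !trS.
Qed.

Lemma in_Schur_bb l i : in_Schur l (bb F r l i).
Proof.
have [il|li] := leqP i l.
  by apply/in_SchurP; exists (fun j => 'C(j, l - i)%:R); rewrite bb_orbmx.
rewrite /bb leqNgt li /=; apply: in_Schur_intro => [||s]; rewrite ?mulmx0 ?mul0mx //.
Qed.

End Intertwiners.

(** * Polytabloids *)

Section Polytabloids.
Variables (F : fieldType) (F2 : 2%:R != 0 :> F) (r k : nat) (t : coltab r k).
Hypothesis t_ok : coltab_ok t.
Local Notation W := (word r).
Local Notation signs := {ffun 'I_k -> bool}.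
Local Notation p := (polytabloid F t).

Let pos (s : signs) (c : 'I_k) := if s c then (t c).1 else (t c).2.
Let sgn (s : signs) : F := (-1) ^+ #|[set c | s c]|.

Lemma coltab_inj : injective (fun cb : 'I_k * bool => if cb.2 then (t cb.1).1 else (t cb.1).2).
Proof.
set f := fun cb => _.
pose e := [seq (c, b) | c <- enum 'I_k, b <- [:: true; false]].
have ue : uniq e.
  apply: allpairs_uniq => //; first exact: enum_uniq.
  by move=> [c b] [c' b'].
have uf : uniq (map f e) by rewrite map_allpairs.
have pe : perm_eq e (enum {: 'I_k * bool}).
  apply: uniq_perm => //; first exact: enum_uniq.
  move=> [c b]; rewrite mem_enum; apply/allpairsP.
  by exists (c, b); rewrite mem_enum; case: b.
by apply/injectiveP; rewrite /injectiveb /dinjectiveb -(perm_uniq (perm_map f pe)).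
Qed.

Lemma pos_inj s : injective (pos s).
Proof. by move=> c c' e; case: (@coltab_inj (c, s c) (c', s c') e). Qed.

Lemma twos_tab_word s : twos (tab_word t s) = pos s @: [set: 'I_k].
Proof.
apply/setP=> q; rewrite inE ffunE; apply/existsP/imsetP => [[c /eqP->]|[c _ ->]].
  by exists c.
by exists c; rewrite eqxx.
Qed.

Lemma card_tab_word s : #|twos (tab_word t s)| = k.
Proof. by rewrite twos_tab_word card_imset ?cardsT ?card_ord //; apply: pos_inj. Qed.

Lemma tab_word_inj : injective (tab_word t).
Proof.
move=> s s' e; apply/ffunP=> c.
have : pos s c \in twos (tab_word t s') by rewrite -e twos_tab_word imset_f.
rewrite twos_tab_word => /imsetP[c' _ ecc'].
by case: (@coltab_inj (c, s c) (c', s' c') ecc') => -> ->.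
Qed.

Lemma sgnE s : sgn s = \prod_c (-1) ^+ s c.
Proof. by rewrite /sgn prodrXr -sum1dep_card big_mkcond; congr (_ ^+ _); apply: eq_bigr => c _; case: (s c). Qed.

Let flip (d s : signs) : signs := [ffun c => s c (+) d c].

Lemma sgn_flip d s : sgn (flip d s) = sgn s * sgn d.
Proof.
rewrite !sgnE -big_split; apply: eq_bigr => c _.
by rewrite ffunE signr_addb.
Qed.

Lemma flip_inj d : injective (flip d).
Proof.
by move=> s s' /ffunP e; apply/ffunP=> c; have := e c; rewrite !ffunE => /addIb.
Qed.

(** The alternating sum for the standard position, V being the second row of [t]: the k - |s|
    unswapped columns form the intersection. *)
Let alt (a : nat -> F) : F := \sum_s sgn s * a (k - #|[set c | s c]|)%N.

Lemma card_tab_wordI s (V : {set 'I_r}) :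
  #|twos (tab_word t s) :&: V| = #|[set c | pos s c \in V]|.
Proof.
rewrite twos_tab_word -(card_imset _ (@pos_inj s)); apply: eq_card => q.
rewrite !inE; apply/andP/imsetP => [[/imsetP[c _ ->] h]|[c]].
  by exists c; rewrite ?inE.
by rewrite inE => h ->; split=> //; apply: imset_f.
Qed.

(* Exchanging the two entries of a column preserves the intersection size with
   [V] if [V] contains both or none of them; if [V] contains exactly one entry
   of each column, a change of signs moves [V] to a standard position. *)
Lemma alternating_sum (V : {set 'I_r}) : exists d : F, forall a,
  \sum_s sgn s * a #|twos (tab_word t s) :&: V| = d * alt a.
Proof.
have [/forallP h|] := boolP [forall c, ((t c).1 \in V) != ((t c).2 \in V)].
  pose d : signs := [ffun c => (t c).1 \in V].
  exists (sgn d) => a; rewrite (reindex_inj (@flip_inj d)) /= mulr_sumr.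
  apply: eq_bigr => s _; rewrite sgn_flip [sgn s * _]mulrC -mulrA; congr (_ * (_ * a _)).
  rewrite card_tab_wordI -[k in (k - _)%N]card_ord -(cardsC [set c | s c]) addKn.
  apply: eq_card => c; rewrite !inE /pos !ffunE.
  have := h c; case A: ((t c).1 \in V); case B: ((t c).2 \in V) => // _.
    by case: (s c); rewrite /= ?A ?B.
  by case: (s c); rewrite /= ?A ?B.
rewrite negb_forall => /existsP[c0]; rewrite negbK => /eqP hc.
exists 0 => a; rewrite mul0r.
pose d : signs := [ffun c => c == c0].
set S := \sum_s _; have : S = - S.
  rewrite {1}/S (reindex_inj (@flip_inj d)) /= -sumrN; apply: eq_bigr => s _.
  rewrite sgn_flip (_ : sgn d = -1); last first.
    rewrite /sgn (_ : [set c | d c] = [set c0]) ?cards1 //.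
    by apply/setP=> c; rewrite !inE ffunE.
  rewrite mulrN1 mulNr; congr (- (_ * a _)); rewrite !card_tab_wordI.
  apply: eq_card => c; rewrite !inE /pos ffunE [d c]ffunE.
  by case: eqP => [->|_]; rewrite ?addbF // addbT; case: (s c0); rewrite /= hc.
move/eqP; rewrite -subr_eq0 opprK -mulr2n -mulr_natr mulf_eq0 (negPf F2) orbF.
by move/eqP.
Qed.

Lemma alt_top : alt (fun j => (j == k)%:R) = 1.
Proof.
rewrite /alt (bigD1 [ffun => false]) //= big1 => [|s s0].
  rewrite /sgn (_ : [set c | _] = set0) ?cards0 ?subn0 ?eqxx ?mulr1 ?addr0 //.
  by apply/setP=> c; rewrite !inE ffunE.
have [c sc] : exists c, s c.
  apply/existsP; apply: contraR s0; rewrite negb_exists => /forallP h.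
  by apply/eqP/ffunP=> c; rewrite ffunE; apply/negbTE.
(* Subtraction is truncated, so k - n = k would also hold for k = 0. *)
have k0 : (0 < k)%N by case: c sc => c ck _; apply: leq_ltn_trans ck.
have : (0 < #|[set c | s c]|)%N by apply/card_gt0P; exists c; rewrite inE.
move: #|_| => n n0; case: eqP => [e|_]; last by rewrite mulr0.
by exfalso; move: e n0 k0; clear; lia.
Qed.

Lemma polytabloid_wmx (c : W -> W -> F) v :
  (p *m wmx c) 0 (enum_rank v) = \sum_s sgn s * c (tab_word t s) v.
Proof.
rewrite mxE sum_dimE.
under eq_bigr => w _ do rewrite wmxE mxE enum_rankK mulr_suml.
rewrite exchange_big; apply: eq_bigr => s _ /=.
rewrite (bigD1 (tab_word t s)) //= eqxx mulr1 big1 ?addr0 // => w /negPf->.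
by rewrite mulr0 mul0r.
Qed.

(** By [alternating_sum] each coordinate of the image is [alt a] times a number independent of [a].
    All images of p are therefore proportional, and the map with [alt] equal to 1 serves as the
    norm. *)
Lemma polytabloid_orbmx l a :
  p *m orbmx r k l a = alt a *: (p *m orbmx r k l (fun j => (j == k)%:R)).
Proof.
apply/rowP=> j; rewrite -[j]enum_valK [RHS]mxE /orbmx !polytabloid_wmx.
have [d dE] := alternating_sum (twos (enum_val j)).
have E a' : \sum_s sgn s * (((#|twos (tab_word t s)| == k) && (#|twos (enum_val j)| == l))%:R
      * a' #|twos (tab_word t s) :&: twos (enum_val j)|)
   = (#|twos (enum_val j)| == l)%:R * (d * alt a').
  rewrite -dE mulr_sumr; apply: eq_bigr => s _.
  by rewrite card_tab_word eqxx /= mulrCA.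
by rewrite (E a) (E (fun j => (j == k)%:R)) alt_top mulr1 mulrA mulrC.
Qed.

Lemma polytabloid_one : p *m one_lam F r k = p.
Proof.
apply/rowP=> j; rewrite -[j]enum_valK polytabloid_wmx mxE enum_rankK.
by apply: eq_bigr => s _; rewrite card_tab_word eqxx andbT eq_sym.
Qed.

Lemma polytabloid_f l a : (k <= l)%N ->
  p *m orbmx r k l a = alt a *: (p *m f_div F r (l - k)).
Proof.
move=> kl; rewrite polytabloid_orbmx -{2}polytabloid_one -mulmxA one_f_orbmx.
by rewrite subnKC.
Qed.

(** The normalising map is zero, since no word with l < k entries 2 meets another in k positions. *)
Lemma polytabloid_orbmx_small l a : (l < k)%N -> p *m orbmx r k l a = 0.
Proof.
move=> lk; rewrite polytabloid_orbmx (_ : orbmx _ _ _ _ = 0) ?mulmx0 ?scaler0 //.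
apply/matrixP=> i j; rewrite !mxE.
have [/andP[_ /eqP jl]|_] := boolP (_ && _); last by rewrite mul0r.
have : (#|twos (enum_val i) :&: twos (enum_val j)| <= l)%N.
  by rewrite -jl subset_leq_card ?subsetIr.
by case: eqP => [->|_]; rewrite ?mulr0 // leqNgt lk.
Qed.

(** So p is a highest weight vector: e^(i) is an S_r-map into words with fewer than k entries 2. *)
Lemma polytabloid_e i : (0 < i)%N -> p *m e_div F r i = 0.
Proof.
move=> i0; rewrite -polytabloid_one -mulmxA.
have [ik|ki] := leqP i k.
  by rewrite one_e_orbmx // polytabloid_orbmx_small //; lia.
rewrite mul_one_lam (_ : wmx _ = 0) ?mulmx0 //.
apply/matrixP=> u v; rewrite !mxE mulnb_natr (_ : _ && _ = false) //; lia.
Qed.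

(** The 2^k words of a polytabloid are distinct and have coefficients 1 and -1. The value is
    non-zero in characteristic 3. *)
Lemma polytabloid_norm : (p *m p^T) 0 0 = 2%:R ^+ k.
Proof.
rewrite mxE sum_dimE.
under eq_bigr => w _ do rewrite [p^T _ _]mxE [X in X * _]mxE enum_rankK mulr_suml.
rewrite exchange_big /=.
transitivity (\sum_(s : signs) (1 : F)).
  apply: eq_bigr => s _.
  rewrite (bigD1 (tab_word t s)) //= eqxx mulr1 big1 ?addr0 => [|w /negPf->]; last first.
    by rewrite mulr0 mul0r.
  rewrite mxE enum_rankK (bigD1 s) //= eqxx mulr1 big1 ?addr0 => [|s' /negPf ns].
    by rewrite -expr2 sqrr_sign.
  by rewrite (inj_eq tab_word_inj) eq_sym ns mulr0.
by rewrite sumr_const card_ffun card_bool card_ord natrX.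
Qed.

End Polytabloids.

Lemma coltab_exists r k : (2 * k <= r)%N -> exists t : coltab r k, coltab_ok t.
Proof.
move=> kr.
have A (c : 'I_k) : (c < r)%N by have := ltn_ord c; lia.
have B (c : 'I_k) : (k + c < r)%N by have := ltn_ord c; lia.
exists [ffun c => (Ordinal (A c), Ordinal (B c))].
rewrite /coltab_ok; set e := flatten _.
have -> : e = [seq (if cb.2 then Ordinal (A cb.1) else Ordinal (B cb.1)) |
     cb <- [seq (c, b) | c <- enum 'I_k, b <- [:: true; false]]].
  rewrite map_allpairs /e; congr flatten; apply: eq_map => c.
  by rewrite !ffunE.
rewrite map_inj_in_uniq.
  apply: allpairs_uniq => //; first exact: enum_uniq.
  by move=> [c b] [c' b'].
move=> [c b] [c' b'] _ _ /(congr1 val) /=.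
have := ltn_ord c; have := ltn_ord c'.
case: b b' => [] [] /= h1 h2 h3; try lia.
  by congr (_, _); apply: val_inj.
by congr (_, _); apply: val_inj => /=; lia.
Qed.

(** * Young modules *)

Lemma cubeD (R : pzRingType) (x y : R) : 3%:R = 0 :> R -> GRing.comm x y ->
  (x + y) ^+ 3 = x ^+ 3 + y ^+ 3.
Proof.
move=> R3 xy; rewrite exprDn_comm // !big_ord_recr big_ord0 /= add0r.
rewrite !expr0 mulr1 mul1r bin0 binn !mulr1n.
rewrite (mulrn_mod3 _ _ R3) [X in _ + X + _](mulrn_mod3 _ _ R3) !mulr0n !addr0 //.
Qed.

Lemma cube_sum (R : pzRingType) n (x : nat -> R) : 3%:R = 0 :> R ->
  (forall i j, GRing.comm (x i) (x j)) ->
  (\sum_(i < n) x i) ^+ 3 = \sum_(i < n) x i ^+ 3.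
Proof.
move=> R3 xC; elim: n => [|n IH]; first by rewrite !big_ord0 expr0n.
rewrite !big_ord_recr /= cubeD ?IH //.
by apply: commr_sym; apply: commr_sum.
Qed.

Lemma comm_eprod (R : pzRingType) N (b : nat -> R) m g x :
  (forall i, GRing.comm x (b i)) -> GRing.comm x (eprod N b m g).
Proof.
move=> xb; apply: commrM => //; apply: commr_prod => u _.
by apply: T3_comm.
Qed.

Lemma natr3_mx (F : fieldType) n : (3 \in [pchar F])%N -> 3%:R = 0 :> 'M[F]_n.
Proof.
move=> ch; have F3 : 3%:R = 0 :> F by apply/eqP; rewrite -(dvdn_pcharf ch).
by rewrite -[LHS]scaler_nat F3 scale0r.
Qed.

(** * Primitivity of e_{m,g} *)

Section Main.
Variables (F : fieldType) (charF3 : (3 \in [pchar F])%N) (r l1 l2 : nat).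
Hypotheses (hl : (l2 <= l1)%N) (hr : (l1 + l2)%N = r).

Lemma e_div0 : e_div F r 0 = 1%:M.
Proof.
apply/matrixP=> i j; rewrite !mxE addn0 -(inj_eq enum_val_inj).
rewrite -(inj_eq (@twos_inj r)) [in RHS]eq_sym eqEcard.
have [h|_] := boolP (twos (enum_val j) \subset _); last by [].
by rewrite eqn_leq (subset_leq_card h) andbT.
Qed.

Lemma bb0 l : bb F r l 0 = one_lam F r l.
Proof. by rewrite bbE -tr_e_div e_div0 trmx1 !mulmx1. Qed.

Lemma emg_factorE m g u : emg_factor F r l2 m g u =
  T3 (fun i => bb F r l2 (i * 3 ^ u)) (fac3 (digit3 g u) (digit3 (m + 2 * g) u)).
Proof.
have F3 := @natr3_mx F (dimE r) charF3.
have N2 (X : 'M[F]_(dimE r)) : X *+ 2 = - X.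
  by apply/eqP; rewrite -subr_eq0 opprK -mulrSr -mulr_natr F3 mulr0.
rewrite /emg_factor /T3 mul0n mul1n bb0.
by case: (digit3 g u) (digit3 (m + 2 * g) u) => [|[|[|?]]] [|[|[|?]]] //=;
  rewrite ?mulr1n ?mulr0n ?add0r ?addr0 ?N2 // addrC.
Qed.

Lemma e_mgE m g : e_mg F r l2 m g = eprod r.+1 (bb F r l2) m g.
Proof.
rewrite /eprod /e_mg (eq_bigr _ (fun (u : 'I_r.+1) _ => emg_factorE m g u)).
(* The product has at least the factor u = 0, which absorbs the unit [b 0]. *)
rewrite big_ord_recl mulrA.
congr (_ * _); rewrite /T3 /= !mulrDr !mulrnAr.
by rewrite !(bsys0l (bsys_bb F hl hr)).
Qed.

Local Notation m := (l1 - l2)%N.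
Let bs : bsys m (bb F r l2) := bsys_bb F hl hr.

Lemma in_Schur_emg g : in_Schur l2 (e_mg F r l2 m g).
Proof.
rewrite e_mgE; apply: in_Schur_intro => [||s].
- by rewrite -bb0; apply: eprod_idl.
- rewrite -bb0 -[LHS]/(_ * _) -[LHS](@comm_eprod _ _ (bb F r l2)) ?eprod_idl //.
  by move=> i; apply: (bsysC bs).
- apply/esym/(@comm_eprod _ _ (bb F r l2)) => i.
  by apply/esym/in_Schur_comm/in_Schur_bb.
Qed.

Lemma emg_primitive g : ~~ (3 %| Bmg m g)%N -> e_mg F r l2 m g != 0 ->
  primitive_idem l2 (e_mg F r l2 m g).
Proof.
move=> nz e0; split=> //; first exact: in_Schur_emg.
  by rewrite e_mgE (eprod_idem (natr3_mx _ charF3) _ bs).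
move=> e1 e2 S1 S2 e11 e22 e12 e21 eE.
have [c cE] := in_Schur_span S1.
set e := e_mg _ _ _ _ _ in e0 eE.
have e1e : e1 * e = e1 by rewrite eE mulrDr e11 e12 addr0.
have cubeE (i : 'I_l2.+1) : exists n,
    bb F r l2 i * (bb F r l2 i * (bb F r l2 i * e)) = e *+ n.
  rewrite /e e_mgE; apply: (eprod_cube (natr3_mx _ charF3) bs nz).
  (* The r + 1 digits suffice for every index: i <= l2 <= r < 3^(r+1). *)
  rewrite (leq_trans (ltn_ord i)) // (leq_trans _ (ltn_expl _ _)) //; lia.
have [n nE] := fin_all_exists cubeE.
pose x i := c i *: bb F r l2 i.
have xC i j : GRing.comm (x i) (x j).
  rewrite /GRing.comm /x -!mulmxE -!scalemxAl -!scalemxAr !scalerA [c j * _]mulrC.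
  by congr (_ *: _); apply: (bsysC bs).
(* [e1 = e1 ^+ 3 * e], and cubing is additive on the [x i]. *)
have e1E : e1 = (\sum_(i < l2.+1) c i ^+ 3 * (n i)%:R) *: e.
  have -> : e1 = e1 ^+ 3 * e by rewrite !exprS expr0 mulr1 e11 e11 e1e.
  rewrite {1}cE (cube_sum _ (natr3_mx _ charF3) xC) mulr_suml scaler_suml.
  apply: eq_bigr => i _; rewrite -scalerA scaler_nat -nE /x !exprS expr0 mulr1.
  rewrite -!mulmxE -!mulmxA -!scalemxAl -!scalemxAr !scalerA.
  by rewrite expr0 mulr1.
set z := \sum_(_ < _) _ in e1E.
(* An idempotent scalar is 0 or 1, so that [e1] is 0 or [e]. *)
have zz : z * z = z.
  have ee : e * e = e by rewrite /e e_mgE (eprod_idem (natr3_mx _ charF3) _ bs).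
  move: e11; rewrite e1E -!mulmxE -scalemxAl -scalemxAr scalerA mulmxE ee.
  by move/eqP; rewrite -subr_eq0 -scalerBl scaler_eq0 (negPf e0) orbF subr_eq0 => /eqP.
have [z0|z1] := eqVneq z 0; first by left; rewrite e1E z0 scale0r.
right; move: eE; rewrite e1E.
have -> : z = 1 by apply: (mulfI z1); rewrite mulr1.
by rewrite scale1r -{1}[e]addr0 => /addrI.
Qed.

(** * The vector q = p f^(g) *)

Section Polytabloid.
Variables (k : nat) (t : coltab r k).
Hypotheses (t_ok : coltab_ok t) (kl : (k <= l2)%N).
Local Notation p := (polytabloid F t).
Local Notation g := (l2 - k)%N.
Local Notation q := (p *m f_div F r g).

Let F2 : 2%:R != 0 :> F.
Proof. by rewrite -(dvdn_pcharf charF3). Qed.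

(** In the commutation rule every term with t < i contains e^(i-t), which kills p; only t = i
    survives. *)
Lemma polytabloid_fe i : q *m e_div F r i =
  if (i <= g)%N then (p *m f_div F r (g - i)) *+ 'C(m + g + i, i) else 0.
Proof.
rewrite -{1}(polytabloid_one F t_ok) -!mulmxA (mulmxA (one_lam F r k)).
rewrite f_div_e_div; last by lia.
have -> : (r + i - (2 * k + g) = m + g + i)%N by lia.
rewrite mulmx_sumr; case: leqP => [ig|gi]; last first.
  rewrite big1 // => s /andP[si sg].
  rewrite -scaler_nat -scalemxAr !mulmxA (polytabloid_one F t_ok).
  by rewrite (polytabloid_e F2 t_ok) ?mul0mx ?scaler0 //; lia.
have ib : (i < (i + g).+1)%N by lia.
rewrite (bigD1 (Ordinal ib)) /= ?leqnn // big1 ?addr0 => [|s /andP[/andP[si sg] ne]].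
  rewrite subnn e_div0 mulmx1 -scaler_nat -scalemxAr !mulmxA (polytabloid_one F t_ok).
  by rewrite scaler_nat.
rewrite -scaler_nat -scalemxAr !mulmxA (polytabloid_one F t_ok).
rewrite (polytabloid_e F2 t_ok) ?mul0mx ?scaler0 // subn_gt0 ltn_neqAle si andbT.
by apply: contra ne => /eqP h; apply/eqP/val_inj.
Qed.

Lemma polytabloid_f_one : q *m one_lam F r l2 = q.
Proof.
rewrite -(polytabloid_one F t_ok) -!mulmxA (mulmxA (one_lam F r k)).
rewrite one_f_orbmx subnKC //.
by rewrite orbmx_one.
Qed.

Lemma polytabloid_bb i : q *m bb F r l2 i = q *+ chi m g i.
Proof.
rewrite bbE !mulmxA polytabloid_f_one polytabloid_fe /chi.
case: leqP => [ig|gi]; last by rewrite mul0mx bin_small.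
rewrite -scaler_nat -scalemxAl -mulmxA mul_f_div subnK // bin_sub //.
by rewrite -!scaler_nat -scalemxAr scalerA -natrM mulnC.
Qed.

Lemma polytabloid_fe_norm : q *m q^T = (p *m p^T) *+ 'C(m + 2 * g, g).
Proof.
have ft : (f_div F r g)^T = e_div F r g by rewrite -tr_e_div trmxK.
rewrite trmx_mul ft mulmxA polytabloid_fe leqnn subnn -tr_e_div e_div0 trmx1 mulmx1.
rewrite -!scaler_nat -scalemxAl; congr (('C(_, _))%:R *: _); lia.
Qed.

Lemma polytabloid_emg : ~~ (3 %| Bmg m g)%N -> q *m e_mg F r l2 m g = q.
Proof.
move=> nz; have d0 : (0 < dimE r)%N by apply/card_gt0P; exists [ffun=> false].
(* [eprod_eval] speaks of ring elements, so the row q is placed in a square matrix. *)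
pose j0 := Ordinal d0; pose y : 'M[F]_(dimE r) := delta_mx j0 (0 : 'I_1) *m q.
have qy : delta_mx (0 : 'I_1) j0 *m y = q.
  rewrite mulmxA mul_delta_mx (_ : delta_mx 0 0 = 1%:M) ?mul1mx //.
  by apply/matrixP=> i j; rewrite !mxE !ord1.
have yQ : y * eprod r.+1 (bb F r l2) m g = y.
  apply: (eprod_eval (natr3_mx _ charF3) _ bs nz) => i.
  rewrite -mulmxE -mulmxA polytabloid_bb.
  by rewrite -!scaler_nat -scalemxAr.
by rewrite e_mgE -{1}qy -mulmxA [y *m _]yQ.
Qed.

End Polytabloid.

(** * Direct summands and idempotents *)

Lemma mulmx_idem_sub n' n (X : 'M[F]_(n', n)) (E : 'M[F]_n) :
  E *m E = E -> (X <= E)%MS -> X *m E = X.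
Proof. by move=> EE /submxP[D ->]; rewrite -mulmxA EE. Qed.

Lemma one_lam_comm l s : one_lam F r l *m Sr_mx F s = Sr_mx F s *m one_lam F r l.
Proof. by rewrite -bb0; apply: in_Schur_comm (in_Schur_bb _ _ _ _). Qed.

Lemma proj_comm l (Y W : 'M[F]_(dimE r)) s :
  mxmodule (Sr_repr F r) Y -> mxmodule (Sr_repr F r) W ->
  (Y + W :=: one_lam F r l)%MS -> mxdirect (Y + W) ->
  one_lam F r l *m proj_mx Y W *m Sr_mx F s = Sr_mx F s *m (one_lam F r l *m proj_mx Y W).
Proof.
move=> mY mW YW dx.
have /hom_mxP h : (one_lam F r l <= dom_hom_mx (Sr_repr F r) (proj_mx Y W))%MS.
  by rewrite -YW proj_mx_hom //; apply/mxdirect_addsP.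
by have <- := h s (in_setT s); rewrite [_ *m Sr_repr F r s]one_lam_comm mulmxA.
Qed.

(** The idempotent is the projection onto Y along a complement, preceded by 1_lambda so that it
    vanishes on the other weight spaces. *)
Lemma summand_idem l (Y : 'M[F]_(dimE r)) : is_summand (one_lam F r l) Y ->
  exists E, [/\ in_Schur l E, E *m E = E & (E :=: Y)%MS].
Proof.
case=> mY Yl [[W mW YW dx]]; exists (one_lam F r l *m proj_mx Y W).
have oo := one_lam_idem F r l.
have dx0 := mxdirect_addsP dx.
have Ysub : (one_lam F r l *m proj_mx Y W <= Y)%MS by apply: proj_mx_sub.
have Yone n (X : 'M_(n, _)) : (X <= Y)%MS -> X *m one_lam F r l = X.
  by move=> XY; apply: mulmx_idem_sub oo (submx_trans XY Yl).
split.
- apply: in_Schur_intro => [||s]; first by rewrite mulmxA oo.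
    exact: Yone.
  exact: proj_comm.
- by rewrite mulmxA Yone // proj_mx_id.
- apply/eqmxP; rewrite Ysub /=; apply/submxP; exists Y.
  by rewrite mulmxA Yone // proj_mx_id.
Qed.

(** The orthogonal idempotents e and E - e split the image of E; carried over to Y, this
    decomposition must be trivial, and e is not 0. *)
Lemma indecomposable_idem (Y E e : 'M[F]_(dimE r)) l :
  indecomposable Y -> mx_iso (Sr_repr F r) Y E ->
  in_Schur l E -> E *m E = E -> in_Schur l e -> e *m e = e ->
  e *m E = e -> e != 0 -> E = e.
Proof.
move=> [mY nzY indY] isoYE SE EE Se ee eE nze.
have Ee : E *m e = e by rewrite (in_Schur_mulC SE Se).
have [f uf Ef fY] := mx_iso_sym isoYE.
have modS X : in_Schur l X -> mxmodule (Sr_repr F r) X.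
  by move=> SX; apply/mxmoduleP=> s _; rewrite [X *m _](in_Schur_comm s SX) submxMl.
have eSub : (e <= E)%MS by rewrite -eE submxMl.
have dE : (E - e) *m E = E - e by rewrite mulmxBl EE eE.
have dSub : (E - e <= E)%MS by rewrite -dE submxMl.
have mod_f X : in_Schur l X -> (X <= E)%MS -> mxmodule (Sr_repr F r) (X *m f).
  by move=> SX XE; apply: hom_mxmodule (modS X SX); apply: submx_trans XE Ef.
have sumE : (e + (E - e) :=: E)%MS.
  apply/eqmxP; rewrite addsmx_sub eSub dSub /=.
  by rewrite -{1}[E](subrK e) addrC; apply: addmx_sub_adds.
have := indY (e *m f) ((E - e) *m f) (mod_f e Se eSub)
  (mod_f _ (in_Schur_sub SE Se) dSub).
case.
- apply: eqmx_trans fY; apply: eqmx_trans (eqmxMr f sumE).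
  by apply: eqmx_sym; apply: addsmxMr.
- apply/mxdirect_addsP/eqP; rewrite -submx0; set X := (_ :&: _)%MS.
  have X1 : (X *m invmx f <= e)%MS.
    by rewrite -[e](mulmxK uf) submxMr // capmxSl.
  have X2 : (X *m invmx f <= E - e)%MS.
    by rewrite -[E - e](mulmxK uf) submxMr // capmxSr.
  have dd : (E - e) *m (E - e) = E - e by rewrite mulmxBr dE mulmxBl Ee ee subrr subr0.
  have : X *m invmx f = 0.
    rewrite -(mulmx_idem_sub ee X1) -(mulmx_idem_sub dd X2).
    by rewrite -mulmxA mulmxBl Ee ee subrr mulmx0.
  by move/(congr1 (mulmx^~ f)); rewrite mulmxKV // mul0mx => ->; rewrite submx_refl.
- move/(congr1 (mulmx^~ (invmx f))); rewrite mulmxK // mul0mx => e0.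
  by rewrite e0 eqxx in nze.
- move/(congr1 (mulmx^~ (invmx f))); rewrite mulmxK // mul0mx.
  by move/eqP; rewrite subr_eq0 => /eqP.
Qed.

Lemma Young_summand_idem k (Y E : 'M[F]_(dimE r)) : (2 * k <= r)%N ->
  is_Young k Y -> in_Schur l2 E -> E *m E = E -> mx_iso (Sr_repr F r) Y E ->
  [/\ ~~ (3 %| Bmg m (l2 - k))%N, e_mg F r l2 m (l2 - k) != 0
    & E = e_mg F r l2 m (l2 - k)].
Proof.
move=> kr [[mY Yk [[W mW YW dx]]] indY SpY] SE EE isoYE.
have [t t_ok] := coltab_exists kr.
have F2 : 2%:R != 0 :> F by rewrite -(dvdn_pcharf charF3).
set p := polytabloid F t.
have pY : (p <= Y)%MS.
  by apply: submx_trans SpY; rewrite /Specht (sumsmx_sup t) // genmxE.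
have pp0 : (p *m p^T) 0 0 != 0 by rewrite (polytabloid_norm F t_ok) expf_neq0.
have p0 : p != 0 by apply: contra pp0 => /eqP->; rewrite mul0mx mxE.
have dx0 := mxdirect_addsP dx.
have p1 := polytabloid_one F t_ok; rewrite -/p in p1.
have [f uf Yf fE] := isoYE.
have Eg' : (E <= dom_hom_mx (Sr_repr F r) (invmx f))%MS.
  by rewrite dom_hom_invmx // -fE submxMr.
(* [al] is the map from M^mu over Y into M^lambda, and [be] leads back. Both commute with S_r, and
   their composite fixes p. *)
pose al := one_lam F r k *m proj_mx Y W *m f.
pose be := E *m invmx f.
have piY : (one_lam F r k *m proj_mx Y W <= Y)%MS by apply: proj_mx_sub.
have alE : al *m E = al.
  by apply: mulmx_idem_sub EE _; rewrite -fE submxMr.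
have alC s : al *m Sr_mx F s = Sr_mx F s *m al.
  have /hom_mxP h := submx_trans piY Yf.
  rewrite /al -[_ *m Sr_mx F s](h s (in_setT s)).
  by rewrite [_ *m Sr_repr F r s](proj_comm s mY mW YW dx) !mulmxA.
have beC s : be *m Sr_mx F s = Sr_mx F s *m be.
  have /hom_mxP h := Eg'.
  rewrite /be -[_ *m Sr_mx F s](h s (in_setT s)).
  by rewrite [E *m Sr_repr F r s](in_Schur_comm s SE) !mulmxA.
have [a aE] : exists a, al = orbmx r k l2 a.
  have al1 : al *m one_lam F r l2 = al by rewrite -[in LHS]alE -(mulmxA al) (in_Schur_idr SE).
  by apply: intertwiner_orbmx alC _; rewrite -mulmxA al1 /al !mulmxA one_lam_idem.
have [b bE] : exists b, be = orbmx r l2 k b.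
  apply: intertwiner_orbmx beC _; rewrite /be mulmxA (in_Schur_idl SE).
  apply: mulmx_idem_sub; first exact: one_lam_idem.
  by apply: submx_trans Yk; rewrite -[Y](mulmxK uf) submxMr // fE.
have pal : p *m al = p *m f.
  by rewrite /al (mulmxA p) (mulmxA p) p1 (proj_mx_id dx0 pY).
have pal0 : p *m al != 0.
  apply: contra p0; rewrite pal => /eqP/(congr1 (mulmx^~ (invmx f))).
  by rewrite mulmxK // mul0mx => ->.
have palbe : p *m al *m be = p.
  by rewrite /be mulmxA -(mulmxA p) alE pal mulmxK.
have kl : (k <= l2)%N.
  rewrite leqNgt; apply: contra pal0 => lk.
  by rewrite aE (polytabloid_orbmx_small F2 t_ok).
have Ea := polytabloid_f F2 t_ok a kl; have Eb := polytabloid_f F2 t_ok b kl.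
(* The transpose of [be] is again a map from M^mu to M^lambda, so both p [al] and p [be]^T are
   multiples of q. *)
move: Ea Eb; rewrite -aE -tr_orbmx -bE -/p.
set ca := \sum_(_ : _) _; set cb := \sum_(_ : _) _; set q := p *m f_div F r _ => Ea Eb.
have nz : ~~ (3 %| Bmg m (l2 - k))%N.
  (* <p, p> = <p [al] [be], p> = <p [al], p [be]^T> = ca cb <q, q>, which is a multiple of B(m,g)
     <p, p>. *)
  apply: contra pp0 => d3; rewrite -{1}palbe Ea -mulmxA -[be]trmxK -trmx_mul Eb.
  rewrite -scalemxAl linearZ -scalemxAr (polytabloid_fe_norm t_ok kl).
  rewrite -[_ *+ _]scaler_nat (_ : _%:R = 0); first by rewrite scale0r !scaler0 mxE.
  by apply/eqP; rewrite -(dvdn_pcharf charF3).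
have ca0 : ca != 0 by apply: contra pal0; rewrite Ea => /eqP->; rewrite scale0r.
have q0 : q != 0 by apply: contra pal0; rewrite Ea => /eqP->; rewrite scaler0.
have qE : q *m E = q.
  apply: (scalerI ca0); rewrite scalemxAl -Ea -mulmxA alE //.
have qe : q *m e_mg F r l2 m (l2 - k) = q by apply: (polytabloid_emg t_ok kl nz).
have e0 : e_mg F r l2 m (l2 - k) != 0.
  by apply: contra q0 => /eqP h; rewrite -qe h mulmx0.
split=> //; have [Se ee _ prim] := emg_primitive nz e0.
set e := e_mg _ _ _ _ _ in qe e0 Se ee prim *.
have SeE := in_Schur_mul Se SE.
have eEC : e *m E = E *m e by apply: in_Schur_mulC Se SE.
apply: (indecomposable_idem indY isoYE SE EE Se) => //.
have eEe : e *m (e *m E) = e *m E by rewrite mulmxA [e *m e]ee.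
have eEe' : e *m E *m e = e *m E by rewrite -mulmxA -eEC.
have eEeE : e *m E *m (e *m E) = e *m E by rewrite mulmxA eEe' -mulmxA EE.
(* Primitivity is applied to e = eE + (e - eE). The first part is not 0, since q e E = q, so e =
   eE. *)
case: (prim (e *m E) (e - e *m E) SeE (in_Schur_sub Se SeE)).
- exact: eEeE.
- by rewrite -mulmxE mulmxBl !mulmxBr [e *m e]ee eEe eEe' eEeE subrr subr0.
- by rewrite -mulmxE mulmxBr eEe' eEeE subrr.
- by rewrite -mulmxE mulmxBl eEe eEeE subrr.
- by rewrite addrC subrK.
- by move=> eE0; case/negP: q0; apply/eqP; rewrite -qE -qe -mulmxA eE0 mulmx0.
- by move/eqP; rewrite subr_eq0 => /eqP <-.
Qed.

End Main.

Theorem theorem1p3 (F : fieldType) (charF3 : (3 \in [pchar F])%N)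
    (r l1 l2 mu1 mu2 : nat)
    (hl : (l2 <= l1)%N) (hlr : (l1 + l2)%N = r)
    (hmu : (mu2 <= mu1)%N) (hmur : (mu1 + mu2)%N = r)
    (hsum : exists Y Z : 'M[F]_(dimE r),
        [/\ is_Young mu2 Y, is_summand (one_lam F r l2) Z
          & mx_iso (Sr_repr F r) Y Z]) :
  let m := (l1 - l2)%N in
  let g := (l2 - mu2)%N in
  [/\ ~~ (3 %| Bmg m g)%N,
      primitive_idem l2 (e_mg F r l2 m g),
      exists Y : 'M[F]_(dimE r),
        is_Young mu2 Y /\
        mx_iso (Sr_repr F r) (one_lam F r l2 *m e_mg F r l2 m g) Y
    & forall e' : 'M[F]_(dimE r), primitive_idem l2 e' ->
        (exists Y : 'M[F]_(dimE r),
           is_Young mu2 Y /\ mx_iso (Sr_repr F r) (one_lam F r l2 *m e') Y) ->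
        e' = e_mg F r l2 m g].
Proof.
move=> m g; have kr : (2 * mu2 <= r)%N by lia.
have [Y [Z [YY /summand_idem[E [SE EE EZ]] isoYZ]]] := hsum.
have isoYE : mx_iso (Sr_repr F r) Y E.
  by apply: mx_iso_trans isoYZ (eqmx_iso _ (eqmx_sym EZ)).
have [nz e0 eE] := Young_summand_idem charF3 hl hlr kr YY SE EE isoYE.
split=> //; first exact: emg_primitive.
  by exists Y; split=> //; rewrite -eE (in_Schur_idl SE); apply: mx_iso_sym.
move=> e' [Se' ee' _ _] [Y' [YY' isoY']].
rewrite (in_Schur_idl Se') in isoY'.
(* The lemma holds for any Young module of shape mu, so Y' need not be compared with Y. *)
by have [_ _] := Young_summand_idem charF3 hl hlr kr YY' Se' ee' (mx_iso_sym isoY').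
Qed.
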